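(* Let $\mathbb{M}=(\Omega,(\mathcal{F}_t)_{t\ge0},(X_t)_{t\ge0},(P_x)_{x\in E_\triangle})$ be a right process with state space $E$ for which $\mu$ is excessive, as in the context. Then $\mathbb{M}$ is transient if and only if there exists a sequence of Borel finely open sets $(B_n)_{n\ge1}$ increasing to $E$ up to some $\mu$-negligible set such that for any $n\ge1$ $$P_x(L_{B_n}<\infty)=1\quad\text{for }\mu\text{-a.e. }x\in E.$$
   Context: $E$ is a Hausdorff topological space whose Borel $\sigma$-algebra $\mathcal{B}(E)$ is generated by the continuous functions on $E$; $\mu$ is a $\sigma$-finite positive measure on $\mathcal{B}(E)$. $\mathbb{M}$ is a right process with state space $E$, cemetery $\triangle$, $E_\triangle=E\cup\{\triangle\}$, life time $\zeta$ (functions on $E$ are extended by $0$ at $\triangle$), and semigroup $p_tf(x)=E_x[f(X_t)]$, $t>0$, where $E_x$ is expectation with respect to $P_x$. It is assumed that $\mu$ is excessive relative to $(p_t)_{t>0}$: $\int_E p_t1_A\,d\mu\le\mu(A)$ for all $A\in\mathcal{B}(E)$, $t>0$. A function $u\ge0$ on $E$ is excessive if $p_tu(x)\nearrow u(x)$ as $t\searrow0$ for all $x\in E$; it is assumed that excessive functions are nearly Borel measurable with respect to $\mathbb{M}$. ''Finely open'' refers to the fine topology of $\mathbb{M}$. $\mathbb{M}$ is transient if there exists $g\in L^1(E,\mu)$ with $g>0$ $\mu$-a.e. such that $E_x[\int_0^\infty g(X_t)\,dt]<\infty$ for $\mu$-a.e. $x\in E$. For a set $B\subset E$, the last exit time from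 $B$ is $L_B(\omega):=\sup\{t\ge0: X_t(\omega)\in B\}$ (with $\sup\emptyset=0$). *)

(* Defs.v *)
From HB Require Import structures.
From mathcomp Require Import all_boot all_order all_algebra.
From mathcomp Require Import all_classical all_reals all_analysis.
From mathcomp Require Import measurable_realfun.
Set Implicit Arguments.
Unset Strict Implicit.
Unset Printing Implicit Defensive.
Import Order.TTheory GRing.Theory Num.Theory.
Import numFieldNormedType.Exports.
Local Open Scope classical_set_scope.
Local Open Scope ring_scope.
Local Open Scope ereal_scope.

Notation borel T := (g_sigma_algebraType (@open T)).

Definition borel_generated_by_continuous (R : realType) (E : ptopologicalType) :=
  <<s @open E >> =
  <<s [set A | exists f : E -> R,
        continuous f /\ exists2 U : set R, open U & A = f @^-1` U] >>.

(* E_\triangle: the cemetery None is an isolated point. *)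
Definition cemetery (E : Type) : Type := option E.

Section cemetery_topology.
Variable E : ptopologicalType.

Definition cemetery_open : set (set (cemetery E)) :=
  [set A | open ((@Some E) @^-1` A)].

Lemma cemetery_openT : cemetery_open setT.
Proof. exact: openT. Qed.

Lemma cemetery_openI : setI_closed cemetery_open.
Proof. by move=> A B oA oB; exact: openI. Qed.

Lemma cemetery_open_bigU (I : Type) (f : I -> set (cemetery E)) :
  (forall i, cemetery_open (f i)) -> cemetery_open (\bigcup_i f i).
Proof.
move=> of_; rewrite /cemetery_open /= preimage_bigcup.
by apply: bigcup_open => i _; exact: of_.
Qed.

HB.instance Definition _ := Pointed.copy (cemetery E) (option E).
HB.instance Definition _ := isOpenTopological.Build (cemetery E)
  cemetery_openT cemetery_openI cemetery_open_bigU.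
End cemetery_topology.

Definition ext0 (R : realType) (E : Type) (f : E -> \bar R)
  (z : cemetery E) : \bar R := if z is Some x then f x else 0.

(* B belongs to the completion of the sigma-algebra under every probability. *)
Definition universally_measurable_set (R : realType) d (T : measurableType d)
    (A : set T) :=
  forall nu : probability T R, exists B C : set T,
    [/\ measurable B, measurable C, B `<=` A, A `<=` C & nu (C `\` B) = 0].

Definition universally_measurable (R : realType) d (T : measurableType d)
    (f : T -> \bar R) :=
  forall B : set (\bar R), measurable B ->
    universally_measurable_set R (f @^-1` B).

(* Q = P_nu.  The integral of a nonnegative function is the supremum over the
   simple functions below it, so it is the expected one when the integrand is
   only universally measurable. *)
Definition initial_law (R : realType) d d' (T : measurableType d)
    (Omega : measurableType d') (P : T -> probability Omega R)
    (nu : probability T R) (Q : probability Omega R) :=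
  forall A, measurable A -> Q A = \int[nu]_z P z A.

(* Z = Q[A | G] Q-almost surely. *)
Definition is_cond_prob (R : realType) d (Omega : measurableType d)
    (Q : probability Omega R) (G : set (set Omega)) (A : set Omega)
    (Z : Omega -> \bar R) :=
  exists Y : Omega -> \bar R,
    [/\ forall B : set (\bar R), measurable B -> G (Y @^-1` B),
        Q.-integrable setT Y,
        forall L, G L -> \int[Q]_(w in L) Y w = Q (A `&` L)
      & {ae Q, forall w, Z w = Y w}].

Section stopping_times.
Variables (R : realType) (d : measure_display) (Omega : measurableType d).
Implicit Types (F : R -> set (set Omega)) (tau : Omega -> \bar R).

Definition right_continuous_filtration F :=
  [/\ forall t, (0 <= t)%R -> sigma_algebra setT (F t),
      forall t, (0 <= t)%R -> F t `<=` measurable,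
      forall s t, (0 <= s)%R -> (s <= t)%R -> F s `<=` F t
    & forall t, (0 <= t)%R -> \bigcap_(s in [set s | (t < s)%R]) F s `<=` F t].

Definition stopping_time F tau :=
  (forall w, 0 <= tau w) /\
  forall t, (0 <= t)%R -> F t [set w | tau w <= t%:E].

Definition stopped_sigma_algebra F tau : set (set Omega) :=
  [set L | measurable L /\
    forall t, (0 <= t)%R -> F t (L `&` [set w | tau w <= t%:E])].

(* X_\infty = \triangle *)
Definition sample (E : Type) (X : R -> Omega -> cemetery E) tau (w : Omega) :
    cemetery E :=
  if tau w is t%:E then X t w else None.

End stopping_times.

(* Right processes as in Ma and Rockner, Introduction to the theory of
   (non-symmetric) Dirichlet forms, Section IV.1.  Times are reals constrained
   to be nonnegative.  Constant stopping times in rp_strong give the simple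
   Markov property.  No completeness of the sigma-algebras is assumed: events
   of probability one are those whose complement is negligible. *)
Record right_process (R : realType) (E : ptopologicalType)
    (d : measure_display) (Omega : measurableType d) := RightProcess {
  rp_filtration : R -> set (set Omega) ;
  rp_X : R -> Omega -> cemetery E ;
  rp_zeta : Omega -> \bar R ;
  rp_shift : R -> Omega -> Omega ;
  rp_P : borel (cemetery E) -> probability Omega R ;
  rp_filtrationP : right_continuous_filtration rp_filtration ;
  rp_adapted : forall t, (0 <= t)%R -> forall A : set (borel (cemetery E)),
    measurable A -> rp_filtration t (rp_X t @^-1` A) ;
  rp_zeta_ge0 : forall w, 0 <= rp_zeta w ;
  rp_lifetime : forall t w, (0 <= t)%R ->
    (rp_X t w = None <-> rp_zeta w <= t%:E) ;
  rp_shiftP : forall s t w, (0 <= s)%R -> (0 <= t)%R ->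
    rp_X s (rp_shift t w) = rp_X (s + t)%R w ;
  rp_P_univ : forall A, measurable A ->
    universally_measurable (fun z => rp_P z A) ;
  rp_P_borel : forall A,
    <<s [set A' | exists s : R, (0 <= s)%R /\
          exists2 B : set (borel (cemetery E)),
            measurable B & A' = rp_X s @^-1` B] >> A ->
    measurable_fun setT (fun z => rp_P z A) ;
  rp_normal : forall z, rp_P z [set w | rp_X 0%R w = z] = 1 ;
  rp_right_continuous : forall w t, (0 <= t)%R ->
    rp_X s w @[s --> t^'+] --> rp_X t w ;
  rp_strong : forall (nu : probability (borel (cemetery E)) R)
      (Q : probability Omega R), initial_law rp_P nu Q ->
    forall tau, stopping_time rp_filtration tau ->
    forall t, (0 <= t)%R -> forall A : set (borel (cemetery E)),
    measurable A ->
    is_cond_prob Q (stopped_sigma_algebra rp_filtration tau)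
      [set w | A (sample rp_X (fun w' => tau w' + t%:E) w)]
      (fun w => rp_P (sample rp_X tau w) [set w' | A (rp_X t w')])
}.

Definition semigroup (R : realType) (E : ptopologicalType) d
    (Omega : measurableType d) (M : right_process R E Omega)
    (t : R) (f : E -> \bar R) (x : E) : \bar R :=
  \int[rp_P M (Some x)]_w ext0 f (rp_X M t w).

Definition excessive_for (R : realType) (E : ptopologicalType)
    (q : R -> (E -> \bar R) -> E -> \bar R) (u : E -> \bar R) :=
  [/\ forall x, 0 <= u x,
      universally_measurable (u : borel E -> \bar R),
      forall s t x, (0 < s)%R -> (s <= t)%R -> q t u x <= q s u x
    & forall x, q t u x @[t --> 0%R^'+] --> u x].

Section notions.
Variables (R : realType) (E : ptopologicalType) (d : measure_display).
Variables (Omega : measurableType d) (M : right_process R E Omega).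

Definition excessive (u : E -> \bar R) := excessive_for (semigroup M) u.

Definition alpha_excessive (alpha : R) (u : E -> \bar R) :=
  excessive_for
    (fun t f x => (expR (- (alpha * t)))%:E * semigroup M t f x) u.

Definition nearly_borel (u : E -> \bar R) :=
  forall (nu : probability (borel (cemetery E)) R) (Q : probability Omega R),
    initial_law (rp_P M) nu Q ->
  exists f g : borel E -> \bar R,
    [/\ measurable_fun setT f, measurable_fun setT g,
        forall x, f x <= u x <= g x
      & Q.-negligible [set w | exists2 t, (0 <= t)%R &
          ext0 f (rp_X M t w) <> ext0 g (rp_X M t w)]].

(* The coarsest topology on E that makes every alpha-excessive function,
   alpha >= 0, continuous. *)
Definition fine_subbase : set (set E) :=
  [set A | exists (alpha : R) (u : E -> \bar R),
    [/\ (0 <= alpha)%R, alpha_excessive alpha u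
      & exists2 O : set (\bar R), open O & A = u @^-1` O]].

Definition fine_topology : Type := E.
HB.instance Definition _ := Pointed.copy fine_topology E.
HB.instance Definition _ :=
  isSubBaseTopological.Build fine_topology fine_subbase id.

Definition finely_open (A : set E) := open (A : set fine_topology).

Definition excessive_measure (mu : {measure set (borel E) -> \bar R}) :=
  forall (A : set (borel E)) (t : R), measurable A -> (0 < t)%R ->
    \int[mu]_x semigroup M t (EFin \o \1_A) x <= mu A.

Definition transient (mu : {measure set (borel E) -> \bar R}) :=
  exists g : borel E -> R,
    [/\ mu.-integrable setT (EFin \o g),
        {ae mu, forall x, (0 < g x)%R}
      & {ae mu, forall x,
          \int[rp_P M (Some x)]_w
            (\int[lebesgue_measure]_(t in `[0%R, +oo[)
               ext0 (EFin \o g) (rp_X M t w)) < +oo}].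

(* Adding t = 0 to the index set only matters when it is empty, and implements
   sup set0 = 0. *)
Definition last_exit (B : set E) (w : Omega) : \bar R :=
  ereal_sup [set t%:E | t in
    [set t | t = 0%R \/ ((0 <= t)%R /\ ((@Some E) @` B) (rp_X M t w))]].

End notions.

(* Main.v *)
Require Import Defs.
From HB Require Import structures.
From mathcomp Require Import all_boot all_order all_algebra.
From mathcomp Require Import all_classical all_reals all_analysis.
From mathcomp Require Import measurable_realfun.
Set Implicit Arguments.
Unset Strict Implicit.
Unset Printing Implicit Defensive.
Import Order.TTheory GRing.Theory Num.Theory.
Import numFieldNormedType.Exports.
Local Open Scope classical_set_scope.
Local Open Scope ring_scope.
Local Open Scope ereal_scope.

(* Idea.  If M is transient with witness g, made strictly positive, its potential
   u(x) = E_x[int_0^oo g(X_t) dt] is excessive, strictly positive and finite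
   mu-almost everywhere, so the finely open sets B_n = {u > 1/(n+1)} exhaust E.
   By the strong Markov property, if X visits {u >= c} after time k with
   probability b, then c b <= E_x[int_k^oo g(X_t) dt], which tends to 0; hence the
   last exit times are almost surely finite.  To apply the strong Markov property
   at a visit to the Borel set B_n one selects a visiting time measurably and
   replaces B_n by a closed subset visited almost as often, whose debut is a
   stopping time; both steps are instances of Choquet's capacitability theorem
   and avoid completing the filtration.

   Conversely, given B with almost surely finite last exit time, let H(x) be the
   probability that the skeleton X_0, X_1, ... started at x meets B.  Then
   H - p_k H is nonnegative and its potential is at most k by telescoping, while
   at x in B it is positive for k large since p_k H(x) tends to 0.  A convergent
   weighted sum of these functions, over B = B_n, k and a mu-finite cover of E,
   witnesses transience. *)

(** * Analytic sets and capacitability *)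

(** The obstacle throughout is measurability. Visiting [B] after time k and having infinite last
    exit time are projections from time times path space, so nothing puts them in the sigma-algebra
    of [Omega]; they are measured from outside by [outer_gt]. The two uses of capacitability differ
    in their paving: finite unions of compact time intervals times events, whose projections are
    events, give the visiting time; zero sets of continuous functions, to which right continuity of
    paths applies, give the closed subset. The selected time may look into the future, so only the
    law of the position at that time is kept. Excessivity of mu enters where the witness g is made
    positive everywhere: a mu-null set is then charged by no potential, up to a mu-null set of
    starting points. In the converse, an almost surely finite last exit time may have infinite mean,
    so the occupation time of [B] cannot be used directly; the difference H - p_k H has a potential
    bounded by a constant. The skeleton makes H a limit of finite Borel iterations, and its visits
    are visits of X, so finiteness of the last exit time still applies to it. *)

Lemma ltn_bound_family (Q : nat -> nat -> Prop) (n : nat) :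
  (forall i a b, (a <= b)%N -> Q i a -> Q i b) ->
  (forall i, (i < n)%N -> exists N, Q i N) ->
  exists N, forall i, (i < n)%N -> Q i N.
Proof.
move=> Qmono; elim: n => [_|n IH QN]; first by exists 0%N.
have [N1 N1P] := IH (fun i lt_in => QN i (ltnW lt_in)).
have [N2 N2P] := QN n (ltnSn n).
exists (maxn N1 N2) => i; rewrite ltnS leq_eqVlt => /predU1P[->|lt_in].
  exact: Qmono (leq_maxr _ _) N2P.
exact: Qmono (leq_maxl _ _) (N1P _ lt_in).
Qed.

Section capacitability.
Variables (T : Type) (paving : set (set T)).
Hypothesis pavingU : forall A B, paving A -> paving B -> paving (A `|` B).
Hypothesis pavingI : forall A B, paving A -> paving B -> paving (A `&` B).

(* A Suslin scheme indexed by the Baire space.  Requiring K n to be locally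
   nondecreasing in the index replaces the dependence on finite prefixes and
   dispenses with Koenig's lemma in the capacitability theorem. *)
Definition suslin_scheme (K : nat -> (nat -> nat) -> set T) :=
  [/\ forall n b, paving (K n b),
      forall n b, K n.+1 b `<=` K n b
    & forall n b, exists N, forall b', (forall i, (i < N)%N -> (b' i <= b i)%N) ->
        K n b' `<=` K n b].

Definition analytic (A : set T) := exists2 K, suslin_scheme K &
  A = \bigcup_b \bigcap_n K n b.

Lemma scheme_le K n m b : suslin_scheme K -> (m <= n)%N -> K n b `<=` K m b.
Proof.
move=> [_ Kd _]; elim: n => [|n IH]; first by rewrite leqn0 => /eqP ->.
rewrite leq_eqVlt => /predU1P[->//|lt_mn].
exact: subset_trans (Kd n b) (IH lt_mn).
Qed.

Lemma paving_analytic A : paving A -> analytic A.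
Proof.
move=> pA; exists (fun _ _ => A); first split=> [//|n b x //|n b].
  by exists 0%N => b' _ x.
apply/seteqP; split=> [x Ax|x [_ _ /(_ 0%N)]]; last exact.
by exists id.
Qed.

(** The coordinate [b 0] bounds the index of the set instead of selecting it, which keeps the scheme
    monotone in [b] and each level a finite union. A single index is recovered at the end: if every
    i up to [b 0] failed at some level, a common level would fail for all of them. *)
Lemma analytic_bigcup (A : nat -> set T) :
  (forall i, analytic (A i)) -> analytic (\bigcup_i A i).
Proof.
move=> anA0; have anA i := cid2 (anA0 i); pose K i := s2val (anA i).
have KP i : suslin_scheme (K i) by rewrite /K; case: (anA i).
have AE i : A i = \bigcup_b \bigcap_n K i n b by rewrite /K; case: (anA i).
pose sh (b : nat -> nat) := fun i => b i.+1.
pose L n (b : nat -> nat) := [set x | exists2 i, (i <= b 0%N)%N & K i n (sh b) x].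
exists L; first split=> [n b|n b x [i ib]|n b].
- rewrite /L; elim: (b 0%N) => [|k IH].
    rewrite [X in paving X](_ : _ = K 0%N n (sh b)); first by case: (KP 0%N).
    apply/seteqP; split=> [x [i]|x Kx]; last by exists 0%N.
    by rewrite leqn0 => /eqP ->.
  rewrite [X in paving X](_ : _ =
      [set x | exists2 i, (i <= k)%N & K i n (sh b) x] `|` K k.+1 n (sh b)).
    by apply: pavingU => //; case: (KP k.+1).
  apply/seteqP; split=> [x [i]|x [[i ik Kx]|Kx]].
  + by rewrite leq_eqVlt => /predU1P[-> ?|ik ?]; [right|left; exists i].
  + by exists i => //; rewrite ltnW.
  + by exists k.+1.
- by move=> Kx; exists i => //; case: (KP i) => _ + _; apply.
- have [] := @ltn_bound_family (fun i N => forall b',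
      (forall j, (j < N)%N -> (b' j <= sh b j)%N) -> K i n b' `<=` K i n (sh b))
      (b 0%N).+1.
  + move=> i a c le_ac h b' b'P; apply: h => j ja; apply: b'P.
    exact: leq_trans ja le_ac.
  + by move=> i _; case: (KP i) => _ _; apply.
  move=> N NP; exists N.+1 => b' b'P x [i ib' Kx].
  have ib : (i <= b 0%N)%N by apply: leq_trans ib' _; exact: b'P.
  exists i => //; apply: NP Kx => // j jN; exact: b'P.
apply/seteqP; split=> [x [i _]|x [b _ bx]].
  rewrite AE => -[b _ bx].
  exists (fun j => if j is k.+1 then b k else i) => // n _.
  by exists i => //; exact: bx.
suff [i ib Kx] : exists2 i, (i <= b 0%N)%N & forall n, K i n (sh b) x.
  by exists i => //; rewrite AE; exists (sh b).
apply: contrapT => noi.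
have [] := @ltn_bound_family (fun i N => ~ K i N (sh b) x) (b 0%N).+1.
- by move=> i m n mn Km /(scheme_le (KP i) mn).
- move=> i ib; apply: contrapT => /forallNP Ki.
  by apply: noi; exists i => // n; apply: contrapT; exact: Ki.
by move=> N NP; have [i ib] := bx N I; apply: NP.
Qed.

(** One sequence [b] encodes a sequence for every [A i] through [pickle]. Level n tests only the
    schemes of index at most n, so it is a finite intersection; scheme i at level n is tested at
    level max(i, n). *)
Lemma analytic_bigcap (A : nat -> set T) :
  (forall i, analytic (A i)) -> analytic (\bigcap_i A i).
Proof.
move=> anA0; have anA i := cid2 (anA0 i); pose K i := s2val (anA i).
have KP i : suslin_scheme (K i) by rewrite /K; case: (anA i).
have AE i : A i = \bigcup_b \bigcap_n K i n b by rewrite /K; case: (anA i).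
pose pr (i : nat) (b : nat -> nat) := fun j : nat => b (pickle (i, j)).
pose L n (b : nat -> nat) := [set x | forall i, (i <= n)%N -> K i n (pr i b) x].
exists L; first split=> [n b|n b x Lx i ile|n b].
- rewrite /L; elim: {1}n => [|k IH].
    rewrite [X in paving X](_ : _ = K 0%N n (pr 0%N b)); first by case: (KP 0%N).
    by apply/seteqP; split=> [x|x Kx i]; [exact|rewrite leqn0 => /eqP ->].
  rewrite [X in paving X](_ : _ =
      [set x | forall i, (i <= k)%N -> K i n (pr i b) x] `&` K k.+1 n (pr k.+1 b)).
    by apply: pavingI => //; case: (KP k.+1).
  apply/seteqP; split=> [x Kx|x [Kx Kx'] i].
    by split=> [i ik|]; apply: Kx => //; rewrite ltnW.
  by rewrite leq_eqVlt => /predU1P[->//|ik]; apply: Kx.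
- by apply: (scheme_le (KP i) (leqnSn n)); apply: Lx; rewrite ltnW.
- have [] := @ltn_bound_family (fun i N => forall b',
      (forall j, (j < N)%N -> (b' j <= b j)%N) -> K i n (pr i b') `<=` K i n (pr i b))
      n.+1.
  + move=> i a c le_ac h b' b'P; apply: h => j ja; apply: b'P.
    exact: leq_trans ja le_ac.
  + move=> i _; have [_ _ /(_ n (pr i b))[N NP]] := KP i.
    have [] := @ltn_bound_family (fun j M => (pickle (i, j) < M)%N) N.
    * by move=> j a c le_ac ja; exact: leq_trans ja le_ac.
    * by move=> j _; exists (pickle (i, j)).+1.
    move=> M MP; exists M => b' b'P; apply: NP => j jN; apply: b'P.
    exact: MP.
  move=> N NP; exists N => b' b'P x Lx i ile.
  exact: (NP i ile b' b'P x (Lx i ile)).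
apply/seteqP; split=> [x Ax|x [b _ bx] i _].
  have /(fun h i => cid (h i)) bP i : exists b, forall n, K i n b x.
    by have := Ax i I; rewrite AE => -[b _ bx]; exists b => n; exact: bx.
  pose b k := if unpickle k is Some (i, j) then sval (bP i) j else 0%N.
  exists b => // n _ i _; have := svalP (bP i) n.
  congr (K _ _ _ _); apply/funext => j.
  by rewrite /pr /b pickleK.
rewrite AE; exists (pr i b) => // n _.
apply: (scheme_le (KP i) (leq_maxr i n)).
by apply: bx => //; exact: leq_maxl.
Qed.

(** Analytic sets are not stable under complement; asking for both a set and its complement restores
    symmetry. *)
Lemma sigma_algebra_analytic : analytic set0 -> analytic setT ->
  sigma_algebra setT [set A | analytic A /\ analytic (~` A)].
Proof.
move=> an0 anT; split=> [|A [anA anCA]|F FP].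
- by split=> //; rewrite setC0.
- by rewrite setTD; split=> //; rewrite setCK.
- split; first by apply: analytic_bigcup => i; case: (FP i).
  by rewrite setC_bigcup; apply: analytic_bigcap => i; case: (FP i).
Qed.

(* Choquet's capacitability theorem, with big A standing for "the capacity of
   A exceeds a fixed level". *)
Lemma capacitability (big : set T -> Prop) (A : set T) :
  (forall B C, B `<=` C -> big B -> big C) ->
  (forall B : nat -> set T, (forall n, B n `<=` B n.+1) ->
     big (\bigcup_n B n) -> exists n, big (B n)) ->
  analytic A -> big A ->
  exists K : nat -> set T, [/\ forall n, paving (K n), forall n, big (K n),
    forall n, K n.+1 `<=` K n & \bigcap_n K n `<=` A].
Proof.
move=> big_mono big_up [K KP ->] bigA.
(* [G s] is the part of the Suslin set reached by sequences bounded by [s] on its length. As the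
   next bound m grows, [G (rcons s m)] increases to [G s], so bigness survives for some m. *)
pose G (s : seq nat) := \bigcup_(b in [set b : nat -> nat |
   forall i, (i < size s)%N -> (b i <= nth 0%N s i)%N]) \bigcap_n K n b.
have step s : big (G s) -> exists m, big (G (rcons s m)).
  move=> bigs; apply: (big_up (fun m => G (rcons s m))).
    move=> m x [b bs bx]; exists b => // i.
    rewrite size_rcons => ile; apply: leq_trans (bs i _) _.
      by rewrite size_rcons.
    by rewrite !nth_rcons; case: ifP => // _; case: ifP.
  apply: big_mono bigs => x [b bs bx].
  exists (b (size s)) => //; exists b => // i.
  rewrite size_rcons nth_rcons; case: ifPn => [isz _|]; first exact: bs.
  rewrite -leqNgt ltnS => szi isz.
  by have -> : i = size s; [apply/eqP; rewrite eqn_leq szi isz|rewrite eqxx].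
have /cid[beta betaP] : exists beta : nat -> nat,
    forall k, big (G (mkseq beta k)).
  pose next s := if pselect (big (G s)) is left h then sval (cid (step s h)) else 0%N.
  pose S := fix S k := if k is k'.+1 then rcons (S k') (next (S k')) else [::].
  have szS k : size (S k) = k by elim: k => //= k IH; rewrite size_rcons IH.
  have bigS k : big (G (S k)).
    elim: k => [|k IH].
      by apply: big_mono bigA => x [b _ bx]; exists b.
    rewrite /= /next; case: pselect => // h; exact: svalP (cid (step _ h)).
  exists (fun k => next (S k)) => k; suff -> : mkseq (fun k => next (S k)) k = S k by [].
  by elim: k => // k IH; rewrite mkseqS IH.
exists (fun n => K n beta); split=> [n|n|n|x Kx].
- by case: KP.
(* For the N given by local monotonicity at [beta], the set [K n beta] contains the big set
   [G (mkseq beta N)]. *)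
- have [_ _ /(_ n beta)[N NP]] := KP.
  apply: big_mono (betaP N) => x [b bN bx].
  apply: (NP b) => [i iN|]; last exact: bx.
  by have := bN i; rewrite size_mkseq => /(_ iN); rewrite nth_mkseq.
- by case: KP.
- by exists beta.
Qed.
End capacitability.

Lemma closed_inf_in (R : realType) (A : set R) :
  closed A -> A !=set0 -> has_lbound A -> A (inf A).
Proof.
move=> cA A0 lA; apply: cA => U /nbhs_ballP[e /= e0 eU].
have [x Ax xe] := inf_adherent e0 (conj A0 lA).
exists x; split=> //; apply: eU; rewrite /ball/= distrC ger0_norm.
  by rewrite ltrBlDl.
by rewrite subr_ge0; apply: ge_inf.
Qed.

(** * Sets of times and outcomes with measurable projections *)

Section time_rectangles.
Context (R : realType) d (Omega : measurableType d).
Implicit Types A B : set (R * Omega).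

(** Compactness in time makes the infimum of a nonempty section a point of it and nested nonempty
    sections intersect. *)
Inductive rectangles : set (R * Omega) -> Prop :=
| rectangle a b (C : set Omega) : measurable C ->
    rectangles [set p | (a <= p.1 <= b)%R /\ C p.2]
| rectanglesU A B : rectangles A -> rectangles B -> rectangles (A `|` B).

Lemma rectanglesI A B : rectangles A -> rectangles B -> rectangles (A `&` B).
Proof.
move=> rA; elim: rA B => [a b C mC|A1 A2 _ IH1 _ IH2] B rB; last first.
  by rewrite setIUl; apply: rectanglesU; [exact: IH1|exact: IH2].
elim: rB => [a' b' C' mC'|B1 B2 _ IH1 _ IH2]; last first.
  by rewrite setIUr; exact: rectanglesU.
rewrite [X in rectangles X](_ : _ = [set p |
    (Num.max a a' <= p.1 <= Num.min b b')%R /\ (C `&` C') p.2]).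
  by apply: rectangle; exact: measurableI.
apply/seteqP; split=> p /=; rewrite ge_max le_min.
  by move=> [[/andP[-> ->] Cp] [/andP[-> ->] Cp']].
by move=> [/andP[/andP[-> ->] /andP[-> ->]] [? ?]].
Qed.

Lemma rectangles_closed A w : rectangles A -> closed [set s | A (s, w)].
Proof.
elim=> [a b C mC|A1 A2 _ IH1 _ IH2]; last exact: closedU.
have [Cw|nCw] := pselect (C w).
  rewrite [X in closed X](_ : _ = `[a, b]%classic); first exact: interval_closed.
  by apply/seteqP; split=> s /=; rewrite in_itv/=; [case|].
rewrite [X in closed X](_ : _ = set0); first exact: closed0.
by apply/seteqP; split=> s //= [].
Qed.

Lemma rectangles_bounded A : rectangles A ->
  exists a b, forall p, A p -> (a <= p.1 <= b)%R.
Proof.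
elim=> [a b C mC|A1 A2 _ [a1 [b1 IH1]] _ [a2 [b2 IH2]]].
  by exists a, b => p [].
exists (Num.min a1 a2), (Num.max b1 b2) => p.
by rewrite ge_min le_max => -[/IH1|/IH2] /andP[-> ->]; rewrite ?orbT.
Qed.

(** For a single rectangle the event is either [C] or empty, according to whether a <= b and a <= r;
    no projection theorem is involved. *)
Lemma rectangles_hit_measurable A r : rectangles A ->
  measurable [set w | exists2 s, (s <= r)%R & A (s, w)].
Proof.
elim=> [a b C mC|A1 A2 _ IH1 _ IH2].
  have [ab|] := boolP ((a <= b) && (a <= r))%R.
    rewrite [X in measurable X](_ : _ = C)//; apply/seteqP.
    split=> [w [s _ []]//|w Cw]; case/andP: ab => ab ar.
    by exists a => //=; rewrite lexx ab.
  rewrite negb_and => abr; rewrite [X in measurable X](_ : _ = set0)//.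
  apply/seteqP; split=> // w [s sr [/= /andP[as_ sb] _]].
  move: abr; rewrite -!ltNge => /orP[|]; apply/negP; rewrite -leNgt.
    exact: le_trans sb.
  exact: le_trans sr.
rewrite [X in measurable X](_ : _ =
  [set w | exists2 s, (s <= r)%R & A1 (s, w)] `|`
  [set w | exists2 s, (s <= r)%R & A2 (s, w)]); first exact: measurableU.
apply/seteqP; split=> w; first by move=> [s sr [?|?]]; [left|right]; exists s.
by move=> [[s sr ?]|[s sr ?]]; exists s => //; [left|right].
Qed.

Lemma rectangles_proj_measurable A : rectangles A -> measurable (snd @` A).
Proof.
move=> rA; have [a [b Aab]] := rectangles_bounded rA.
rewrite [X in measurable X](_ : _ = [set w | exists2 s, (s <= b)%R & A (s, w)]).
  exact: rectangles_hit_measurable.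
apply/seteqP; split=> w; last by move=> [s _ As]; exists (s, w).
by move=> [[s w'] Asw /= <-]; exists s => //; case/andP: (Aab _ Asw).
Qed.

(** It suffices to treat generators of the product sigma-algebra. Half-lines closed on the left are
    convenient in time: both they and their complements are countable unions of compact
    intervals. *)
Lemma measurable_analytic A : measurable A -> analytic rectangles A.
Proof.
have pU := rectanglesU; have pI := rectanglesI.
have anC (a : R) C : measurable C -> analytic rectangles [set p | (a <= p.1)%R /\ C p.2].
  move=> mC; rewrite [X in analytic _ X](_ : _ =
      \bigcup_n [set p | (a <= p.1 <= n%:R)%R /\ C p.2]).
    by apply: analytic_bigcup => // n; apply: paving_analytic; exact: rectangle.
  apply/seteqP; split=> [p [ap Cp]|p [n _ [/andP[]]]//].
  have [n pn] : exists n : nat, (p.1 <= n%:R)%R.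
    by exists (Num.truncn `|p.1|).+1; rewrite (le_trans (ler_norm _))// ltW// truncnS_gt.
  by exists n => //=; rewrite ap pn.
have anC' C : measurable C -> analytic rectangles (snd @^-1` C).
  move=> mC; rewrite [X in analytic _ X](_ : _ =
      \bigcup_n [set p : R * Omega | (- n%:R <= p.1)%R /\ C p.2]).
    by apply: analytic_bigcup => // n; exact: anC.
  apply/seteqP; split=> [p Cp|p [n _ []]//].
  exists (Num.truncn `|p.1|).+1 => //=; split => //.
  by rewrite lerNl (le_trans (ler_norm _))// normrN ltW// truncnS_gt.
have anT : analytic rectangles setT.
  by rewrite -(preimage_setT snd); exact: anC'.
have an0 : analytic rectangles set0.
  by rewrite -(preimage_set0 snd); exact: anC'.
have sA := sigma_algebra_analytic pU pI an0 anT.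
move=> mA; suff [] : analytic rectangles A /\ analytic rectangles (~` A) by [].
move: A mA; apply: smallest_sub => // A [] [B mB <-]; rewrite setTI; last first.
  by split; [exact: anC'|rewrite preimage_setC; apply: anC'; exact: measurableC].
have {}mB : <<s @RGenCInfty.G R >> B.
  have : (@ocitv R).-sigma.-measurable B by [].
  by rewrite RGenCInfty.measurableE.
have sI := sigma_algebra_image fst sA.
rewrite -[_ @^-1` B]setTI.
suff: image_set_system setT fst
    [set A | analytic rectangles A /\ analytic rectangles (~` A)] B by [].
move: B mB; apply: smallest_sub; first exact: sI.
move=> _ [x ->]; rewrite /image_set_system/= setTI; split.
  rewrite [X in analytic _ X](_ : _ = [set p | (x <= p.1)%R /\ setT p.2]).
    exact: anC.
  by apply/seteqP; split=> p /=; rewrite in_itv/= andbT => // -[].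
rewrite [X in analytic _ X](_ : _ = \bigcup_m \bigcup_n
   [set p : R * Omega | (- m%:R <= p.1 <= x - n.+1%:R^-1)%R /\ setT p.2]).
  apply: analytic_bigcup => // m; apply: analytic_bigcup => // n.
  by apply: paving_analytic; exact: rectangle.
apply/seteqP; split=> [p /=|p [m _ [n _ [/= /andP[_ h] _]]]]; last first.
  rewrite in_itv/= andbT; apply/negP; rewrite -ltNge (le_lt_trans h)//.
  by rewrite ltrBlDr ltrDl invr_gt0.
rewrite in_itv/= andbT => /negP; rewrite -ltNge => px.
exists (Num.truncn `|p.1|).+1 => //; exists (Num.truncn (x - p.1)^-1) => //=; split=> //.
apply/andP; split.
  by rewrite lerNl (le_trans (ler_norm _))// normrN ltW// truncnS_gt.
rewrite lerBrDr -lerBrDl ltW// invf_plt ?posrE// ?subr_gt0//.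
by rewrite truncnS_gt.
Qed.

End time_rectangles.

Section outer_level.
Context (R : realType) d (T : measurableType d) (P : {measure set T -> \bar R}).

(** This says that the outer measure of [A] exceeds a, in a form that mentions measurable covers
    only; it is the notion of bigness fed to [capacitability]. *)
Definition outer_gt (a : \bar R) (A : set T) :=
  forall C, measurable C -> A `<=` C -> a < P C.

Lemma outer_gtS a A B : A `<=` B -> outer_gt a A -> outer_gt a B.
Proof. by move=> AB aA C mC BC; apply: aA => // x /AB /BC. Qed.

(** Otherwise each [A n] has a measurable cover of mass at most a. Intersecting each cover with all
    later ones makes the covers increase, and their union then covers everything with mass at most
    a. *)
Lemma outer_gt_bigcup a (A : nat -> set T) : (forall n, A n `<=` A n.+1) ->
  outer_gt a (\bigcup_n A n) -> exists n, outer_gt a (A n).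
Proof.
move=> Ainc bigA; apply: contrapT => /forallNP nA.
have /(fun h n => cid (h n)) CP n :
    exists C, [/\ measurable C, A n `<=` C & P C <= a].
  have /existsNP[C /not_implyP[mC /not_implyP[AC /negP]]] := nA n.
  by rewrite -leNgt => PC; exists C.
pose D n := \bigcap_(m in [set m | (n <= m)%N]) sval (CP m).
have mC n : measurable (sval (CP n)) by case: (svalP (CP n)).
have mD n : measurable (D n) by apply: bigcap_measurableType => m _.
have AD n : A n `<=` D n.
  move=> x Anx m /= nm; have [_ + _] := svalP (CP m); apply.
  elim: m nm => [|m IH]; first by rewrite leqn0 => /eqP <-.
  rewrite leq_eqVlt => /predU1P[<-//|nm]; exact/Ainc/IH.
have : P (\bigcup_n D n) <= a.
  have cvgD : P (D n) @[n --> \oo] --> P (\bigcup_n D n).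
    apply: nondecreasing_cvg_mu => //; first exact: bigcup_measurable.
    by move=> m n mn; apply/subsetPset => x Dx k /= nk; apply: Dx; exact: leq_trans nk.
  rewrite -(cvg_lim _ cvgD)//; apply: lime_le; first by apply/cvg_ex; eexists; exact: cvgD.
  apply: nearW => n; have [_ _ Pa] := svalP (CP n); apply: le_trans Pa.
  by apply: le_measure; rewrite ?inE//; move=> x; apply => /=.
rewrite leNgt => /negP; apply; apply: bigA; first exact: bigcup_measurable.
by move=> x [n _ /AD Dx]; exists n.
Qed.

Lemma negligible_outer (A : set T) :
  (forall e : R, (0 < e)%R -> ~ outer_gt e%:E A) -> P.-negligible A.
Proof.
move=> nA; have /(fun h n => cid (h n)) CP n :
    exists C, [/\ measurable C, A `<=` C & P C <= n.+1%:R^-1%:E].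
  have /existsNP[C /not_implyP[mC /not_implyP[AC /negP]]] :=
    nA n.+1%:R^-1%R ltac:(by rewrite invr_gt0).
  by rewrite -leNgt => PC; exists C.
have mC n : measurable (sval (CP n)) by case: (svalP (CP n)).
exists (\bigcap_n sval (CP n)); split.
- exact: bigcap_measurableType.
- apply/eqP; rewrite eq_le measure_ge0 andbT; apply/lee_addgt0Pr => e e0.
  rewrite add0e; have [n ne] : exists n : nat, (n.+1%:R^-1 <= e)%R.
    exists (Num.truncn e^-1); rewrite ltW// invf_plt ?posrE//.
    by rewrite truncnS_gt.
  have [_ _ Pn] := svalP (CP n); apply: (@le_trans _ _ (P (sval (CP n)))).
    apply: le_measure; rewrite ?inE//; first exact: bigcap_measurableType.
    by move=> x; apply.
  by rewrite (le_trans Pn)// lee_fin.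
- by move=> x Ax n _; have [_ + _] := svalP (CP n); exact.
Qed.

End outer_level.

(** * Measurable selection of a visiting time *)

Section measurable_section.
Context (R : realType) d (Omega : measurableType d) (P : probability Omega R).

(** Capacitability yields decreasing [K n] with big projections and intersection inside [A]. Over
    the intersection [D] of the projections, the first points of the sections of [K n] increase with
    n; their limit stays in every closed section, hence in [A]. *)
Lemma measurable_section (A : set (R * Omega)) (a : \bar R) : measurable A ->
  outer_gt P a (snd @` A) ->
  exists (D : set Omega) (rho : Omega -> R), [/\ measurable D,
    measurable_fun D rho, a <= P D & forall w, D w -> A (rho w, w)].
Proof.
move=> /measurable_analytic anA bigA.
have [|B Binc|K [rK bigK Kd KA]] := @capacitability _ (@rectangles R d Omega)
   (fun B => outer_gt P a (snd @` B)) A _ _ anA bigA.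
- by move=> B C BC; apply: outer_gtS => w [p Bp <-]; exists p => //; exact: BC.
- move=> bigB; apply: outer_gt_bigcup.
    by move=> n w [p Bp <-]; exists p => //; exact: Binc.
  by apply: outer_gtS bigB => w [p [n _ Bp] <-]; exists n => //; exists p.
have Kle m n : (m <= n)%N -> K n `<=` K m.
  elim: n => [|n IH]; first by rewrite leqn0 => /eqP ->.
  rewrite leq_eqVlt => /predU1P[->//|mn].
  exact: subset_trans (Kd n) (IH mn).
pose D := \bigcap_n (snd @` K n).
have mpK n : measurable (snd @` K n) by exact: rectangles_proj_measurable.
have mD : measurable D by exact: bigcap_measurableType.
pose sec n w := [set s | K n (s, w)].
pose f n w := inf (sec n w).
have [lo [hi Kb]] := rectangles_bounded (rK 0%N).
have secb n w s : sec n w s -> (lo <= s <= hi)%R.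
  by move=> Ks; apply: (Kb (s, w)); exact: (Kle _ n).
have secl n w : has_lbound (sec n w).
  by exists lo => s /secb/andP[].
have sec0 n w : D w -> sec n w !=set0.
  by move=> /(_ n I)[[s w'] Ks /= <-]; exists s.
have fP n w : D w -> sec n w (f n w).
  move=> Dw; apply: closed_inf_in => //; last exact: sec0.
  exact: rectangles_closed.
have ndf w : D w -> nondecreasing_seq (f ^~ w).
  move=> Dw m n mn; apply: ge_inf => //; apply: (Kle _ n) => //.
  exact: fP.
have fcvg w : D w -> f ^~ w @ \oo --> limn (f ^~ w).
  move=> Dw; apply: nondecreasing_is_cvgn; first exact: ndf.
  by exists hi => _ [n _ <-]; case/andP: (secb _ _ _ (fP n w Dw)).
exists D, (fun w => limn (f ^~ w)); split => //.
- apply: measurable_fun_cvg (fcvg) => n mD'.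
  apply: (measurability _ (RGenOInfty.measurableE R)) => //.
  move=> _ [_ [r ->] <-].
  (* Closed sections attain their infimum, so [f n w <= r] means that the section meets the times up
     to r. *)
  rewrite [X in measurable X](_ : _ =
      D `\` [set w | exists2 s, (s <= r)%R & K n (s, w)]).
    by apply: measurableD => //; exact: rectangles_hit_measurable.
  apply/seteqP; split=> w /= [Dw]; rewrite in_itv/= andbT => h; split=> //.
    move=> [s sr Ks]; move: h; apply/negP; rewrite -leNgt.
    by apply: le_trans sr; apply: ge_inf.
  rewrite ltNge; apply/negP => fr; apply: h; exists (f n w) => //.
  exact: fP.
- have cvgD : P (snd @` K n) @[n --> \oo] --> P D.
    apply: nonincreasing_cvg_mu => //; first by rewrite ltey_eq fin_num_measure.
    move=> m n mn; apply/subsetPset => w [p Kp <-]; exists p => //.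
    exact: Kle Kp.
  rewrite -(cvg_lim _ cvgD)//; apply: lime_ge; first by apply/cvg_ex; eexists; exact: cvgD.
  by apply: nearW => n; rewrite ltW//; exact: bigK (mpK n) (@subset_refl _ _).
- move=> w Dw; apply: KA => n _.
  have csec : closed (sec n w) by exact: rectangles_closed.
  suff : sec n w (limn (f ^~ w)) by [].
  apply: closed_cvg csec _ _ (fcvg _ Dw).
  by exists n => // m /= nm; apply: (Kle n m) => //; exact: fP.
Qed.

End measurable_section.

(** * Borel sets of the cemetery extension *)

Section cemetery_borel.
Context (E : ptopologicalType).
Implicit Types A : set E.

Lemma cemetery_openE (A : set (cemetery E)) : open A = open ((@Some E) @^-1` A).
Proof. by []. Qed.

Lemma measurable_Some : measurable_fun setT (@Some E : borel E -> borel (cemetery E)).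
Proof.
apply: (measurability (@open (cemetery E) : set (set (borel (cemetery E))))) => //.
by move=> _ [B oB <-]; rewrite setTI; apply: sub_sigma_algebra.
Qed.

Lemma measurable_image_Some A : measurable (A : set (borel E)) ->
  measurable (@Some E @` A : set (borel (cemetery E))).
Proof.
have mT : measurable (@Some E @` setT : set (borel (cemetery E))).
  apply: sub_sigma_algebra; rewrite cemetery_openE.
  rewrite [X in open X](_ : _ = setT); first exact: openT.
  by apply/seteqP; split=> // x _; exists x.
suff h : <<s @open E >> `<=`
    [set A | measurable (@Some E @` A : set (borel (cemetery E)))] by exact: h.
apply: smallest_sub; first split=> [|B mB|F mF] /=.
- by rewrite image_set0.
- rewrite [X in measurable X](_ : _ = (@Some E @` setT) `\` (@Some E @` B)).
    exact: measurableD.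
  apply/seteqP; split=> [_ [x [_ Bx] <-]|_ [[x _ <-] Bx]].
    by split; [exists x|move=> [y By [] yx]; apply: Bx; rewrite -yx].
  by exists x => //; split=> // Bx'; apply: Bx; exists x.
- by rewrite image_bigcup; apply: bigcupT_measurable => i; exact: mF.
move=> B oB /=; apply: sub_sigma_algebra; rewrite cemetery_openE.
rewrite [X in open X](_ : _ = B)//.
by apply/seteqP; split=> [x [y By [<-]]|x Bx]//; exists x.
Qed.

Lemma measurable_None : measurable ([set None] : set (borel (cemetery E))).
Proof.
apply: sub_sigma_algebra; rewrite cemetery_openE.
by rewrite [X in open X](_ : _ = set0)//; [exact: open0|apply/seteqP; split].
Qed.

Lemma cemetery_set_measurable (A : set (cemetery E)) :
  measurable (@Some E @^-1` A : set (borel E)) ->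
  measurable (A : set (borel (cemetery E))).
Proof.
move=> mA; have mSA := measurable_image_Some mA.
have [AN|nAN] := pselect (A None).
  rewrite [X in measurable X](_ : _ = (@Some E @` (@Some E @^-1` A)) `|` [set None]).
    by apply: measurableU => //; exact: measurable_None.
  apply/seteqP; split=> [[x|] Ax|z [[x Ax <-]|->]]//; first by left; exists x.
  by right.
rewrite [X in measurable X](_ : _ = @Some E @` (@Some E @^-1` A))//.
by apply/seteqP; split=> [[x|] Ax|z [x Ax <-]]//; exists x.
Qed.

(** The value at [None] is unconstrained because the cemetery is isolated. *)
Lemma measurable_cemetery d (T : measurableType d) (f : cemetery E -> T) :
  measurable_fun setT (f \o @Some E : borel E -> T) ->
  measurable_fun setT (f : borel (cemetery E) -> T).
Proof.
move=> mf _ B mB; rewrite setTI; apply: cemetery_set_measurable.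
by rewrite -[X in measurable X]setTI; exact: mf.
Qed.

Lemma measurable_ext0 (R : realType) (f : E -> \bar R) :
  measurable_fun setT (f : borel E -> \bar R) ->
  measurable_fun setT (ext0 f : borel (cemetery E) -> \bar R).
Proof. by move=> mf; exact: measurable_cemetery. Qed.

Lemma continuous_cemetery (R : realType) (f : cemetery E -> R) :
  continuous (f \o @Some E) -> continuous f.
Proof. by move=> /continuousP cf; apply/continuousP => A oA; exact: cf. Qed.

Lemma measurable_cemetery_continuous (R : realType) (f : cemetery E -> R) :
  continuous f -> measurable_fun setT (f : borel (cemetery E) -> R).
Proof.
move=> cf; apply: (measurability _ (RGenOpens.measurableE R)).
move=> _ [_ [x [y ->]] <-]; rewrite setTI; apply: sub_sigma_algebra.
by move/continuousP : cf; apply; exact: interval_open.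
Qed.

End cemetery_borel.

(** * Joint measurability in time and outcome *)

Section joint_measurability.
Context (R : realType) (E : ptopologicalType) (d : measure_display)
  (Omega : measurableType d) (X : R -> Omega -> cemetery E).
Hypothesis borelE : borel_generated_by_continuous R E.
Hypothesis mX : forall t, (0 <= t)%R ->
  measurable_fun setT (X t : Omega -> borel (cemetery E)).
Hypothesis rcX : forall w t, (0 <= t)%R -> X s w @[s --> t^'+] --> X t w.

(** Clamping the time at 0 gives a map on all of [R * Omega], since [X] is controlled at nonnegative
    times only. *)
Let Xp (p : R * Omega) : borel (cemetery E) := X (Num.max p.1 0%R) p.2.

Let m0 (p : R * Omega) : R := Num.max p.1 0%R.

Let m0_ge0 p : (0 <= m0 p)%R. Proof. by rewrite /m0 le_max lexx orbT. Qed.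

Let mm0 : measurable_fun setT m0.
Proof. by apply: measurable_maxr; [exact: measurable_fst|exact: measurable_cst]. Qed.

Lemma joint_measurable_continuous (f : cemetery E -> R) :
  continuous f -> measurable_fun setT (f \o Xp).
Proof.
move=> cf.
have mf := measurable_cemetery_continuous cf.
pose k n (p : R * Omega) := Num.truncn (m0 p * n.+1%:R).
(* Rounding up strictly, hence the successor, so that the sampled times approach [m0 p] from the
   right, where paths are continuous. *)
pose u n (p : R * Omega) : R := ((k n p).+1%:R / n.+1%:R)%R.
pose Y n p := f (X (u n p) p.2).
have kP n p : ((k n p)%:R <= m0 p * n.+1%:R < (k n p).+1%:R)%R.
  by apply: truncn_itv; rewrite mulr_ge0.
apply: (@measurable_fun_cvg _ _ _ _ Y).
  move=> n _ B mB; rewrite setTI.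
  rewrite [X in measurable X](_ : _ = \bigcup_j
     ((fun p => (m0 p * n.+1%:R)%R) @^-1` `[j%:R, j.+1%:R[%classic `&`
      snd @^-1` ((f \o X (j.+1%:R / n.+1%:R)%R) @^-1` B))).
    apply: bigcupT_measurable => j; apply: measurableI.
      rewrite -[X in measurable X]setTI; apply: measurable_funM => //.
    rewrite -[X in measurable X]setTI; apply: measurable_snd => //.
    rewrite -[X in measurable X]setTI.
    by apply: (measurableT_comp mf) => //; apply: mX; rewrite divr_ge0.
  apply/seteqP; split=> [p Bp|p [j _ [/= jp Bp]]].
    by exists (k n p) => //; split=> //=; rewrite in_itv/=.
  suff kj : k n p = j by rewrite /Y /u kj.
  by apply: truncn_def; rewrite in_itv/= in jp.
move=> p _; rewrite /Y /=.
have Xr : f (X s p.2) @[s --> (m0 p)^'+] --> f (X (m0 p) p.2).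
  by apply: continuous_cvg; [exact: cf|exact: rcX].
have := (cvg_at_rightP _ _ _).1 Xr (u ^~ p); apply; split.
  move=> n; rewrite /u ltr_pdivlMr//; by case/andP: (kP n p).
apply/cvgrPdist_le => e e0; near=> n.
have h0 : (m0 p <= u n p)%R by rewrite /u ler_pdivlMr// ltW//; case/andP: (kP n p).
rewrite distrC ger0_norm ?subr_ge0// lerBlDr.
rewrite /u -natr1 mulrDl addrC mul1r lerD//; last first.
  by rewrite ler_pdivrMr//; case/andP: (kP n p).
by rewrite ltW//; near: n; apply: near_infty_natSinv_lt (PosNum e0).
Unshelve. all: by end_near. Qed.

(** Time discretisation reaches only real continuous functions of [X]; [borelE] says that their
    preimages generate the Borel sets of E. Being alive is itself such an event, which separates off
    the cemetery. *)
Lemma joint_measurable : measurable_fun setT Xp.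
Proof.
have mE : measurable (Xp @^-1` (@Some E @` setT)).
  pose f (z : cemetery E) : R := if z is Some _ then 1%R else 0%R.
  have cf : continuous f.
    by apply: continuous_cemetery; rewrite /comp/=; exact: cst_continuous.
  rewrite [X in measurable X](_ : _ = (f \o Xp) @^-1` [set 1%R]).
    by rewrite -[X in measurable X]setTI; exact: joint_measurable_continuous.
  apply/seteqP; split=> p /=; first by move=> [x _ <-].
  by rewrite /f; case: (Xp p) => [x _|/eqP]; [exists x|rewrite eq_sym oner_eq0].
suff h : <<s @open E >> `<=` [set A | measurable (Xp @^-1` (@Some E @` A))].
  move=> _ B mB; rewrite setTI.
  have mB' : <<s @open E >> (@Some E @^-1` B).
    by have := @measurable_Some E measurableT B mB; rewrite setTI.
  have [BN|nBN] := pselect (B None).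
    rewrite [X in measurable X](_ : _ =
        Xp @^-1` (@Some E @` (@Some E @^-1` B)) `|` ~` (Xp @^-1` (@Some E @` setT))).
      by apply: measurableU; [exact: h|exact: measurableC].
    apply/seteqP; split=> p /=; rewrite /preimage/=.
      by case: (Xp p) => [x Bx|_]; [left; exists x|right => -[]].
    by case: (Xp p) => [x [[y By [<-]]|[]]|]//; exists x.
  rewrite [X in measurable X](_ : _ =
      Xp @^-1` (@Some E @` (@Some E @^-1` B))); first exact: h.
  apply/seteqP; split=> p /=; rewrite /preimage/=.
    by case: (Xp p) => [x Bx|//]; exists x.
  by case: (Xp p) => [x [y By [<-]]|[]].
rewrite borelE; apply: smallest_sub; first split=> [|B mB|F mF] /=.
- by rewrite image_set0 preimage_set0.
- rewrite [X in measurable X](_ : _ = Xp @^-1` (@Some E @` setT) `\`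
      Xp @^-1` (@Some E @` B)); first exact: measurableD.
  apply/seteqP; split=> [p [x [_ Bx] xp]|p [[x _ xp] Bx]].
    by split; [exists x|rewrite /preimage/= -xp => -[y By [yx]]; apply: Bx; rewrite -yx].
  by exists x => //; split=> // Bx'; apply: Bx; exists x.
- by rewrite image_bigcup preimage_bigcup; apply: bigcupT_measurable => i; exact: mF.
move=> _ [f [cf [U oU ->]]] /=.
pose g (z : cemetery E) : R := if z is Some x then f x else 0%R.
have cg : continuous g by exact: continuous_cemetery.
rewrite [X in measurable X](_ : _ =
    (g \o Xp) @^-1` U `&` Xp @^-1` (@Some E @` setT)).
  apply: measurableI => //; rewrite -[X in measurable X]setTI.
  by apply: joint_measurable_continuous => //; exact: open_measurable.
apply/seteqP; split=> p; rewrite /preimage/= /g.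
  by move=> [x Ux <-]; split=> //; exists x.
by move=> [+ [x _ xp]]; rewrite -xp => Ux; exists x.
Qed.

End joint_measurability.

(** * Measurability in the starting point and the strong Markov property *)

Section integral_dirac_point.
Import HBNNSimple.

(** [f] is not assumed measurable: z |-> P z A is only universally measurable for general events.
    The supremum over simple functions is attained by one supported at the point a, so a fixed
    starting point is a legitimate initial law for [rp_strong]. *)
Lemma integral_dirac_point (R : realType) d (T : measurableType d) (a : T)
    (f : T -> \bar R) :
  measurable [set a] -> (forall x, 0 <= f x) -> f a \is a fin_num ->
  \int[\d_a]_x f x = f a.
Proof.
move=> ma f0 ffin; rewrite ge0_integralTE//; apply/eqP; rewrite eq_le; apply/andP; split.
  apply: ge_ereal_sup => _ [h /= hf <-].
  have -> : sintegral \d_a h = \int[\d_a]_x (h x)%:E.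
    by rewrite integral_nnsfun// patch_setT.
  rewrite integral_dirac//; last exact/measurable_EFinP.
  by rewrite diracT mul1e.
have fa0 : (0 <= fine (f a))%R by rewrite fine_ge0.
pose h := scale_nnsfun (indic_nnsfun R ma) fa0.
have hE x : h x = (fine (f a) * \1_[set a] x)%R by [].
apply: ereal_sup_ubound; exists h => [x|].
  rewrite hE indicE; have [/set_mem ->|_] := boolP (x \in [set a]).
    by rewrite mulr1 fineK.
  by rewrite mulr0.
have -> : sintegral \d_a h = \int[\d_a]_x (h x)%:E.
  by rewrite integral_nnsfun// patch_setT.
rewrite integral_dirac//; last exact/measurable_EFinP.
by rewrite diracT mul1e hE indicE mem_set// mulr1 fineK.
Qed.

End integral_dirac_point.

Section path_space.
Context (R : realType) (E : ptopologicalType) (d : measure_display)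
  (Omega : measurableType d) (M : right_process R E Omega).
Local Notation X := (rp_X M).
Local Notation P := (rp_P M).
Local Notation cE := (borel (cemetery E)).

Definition path_events : set (set Omega) :=
  [set A' | exists s : R, (0 <= s)%R /\
     exists2 B : set cE, measurable B & A' = X s @^-1` B].

(** On the sigma-algebra generated by the coordinates, z |-> P z A is Borel by [rp_P_borel]; on the
    full one it is only universally measurable. *)
Definition path_space := g_sigma_algebraType path_events.

Lemma measurable_X t : (0 <= t)%R -> measurable_fun setT (X t : Omega -> cE).
Proof.
move=> t0 _ B mB; rewrite setTI.
have [_ + _ _] := rp_filtrationP M; apply; first exact: t0.
exact: rp_adapted.
Qed.

Lemma measurable_X_path t : (0 <= t)%R ->
  measurable_fun setT (X t : path_space -> cE).
Proof.
move=> t0 _ B mB; rewrite setTI; apply: sub_sigma_algebra.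
by exists t; split => //; exists B.
Qed.

Lemma measurable_id_path : measurable_fun setT (id : Omega -> path_space).
Proof.
move=> _ B mB; rewrite setTI; move: B mB; apply: smallest_sub.
  exact: sigma_algebra_measurable.
by move=> _ [s [s0 [B mB ->]]]; rewrite -[X in measurable X]setTI; exact: measurable_X.
Qed.

(** The time component is a dummy: it makes the laws a kernel from [R * cE], so that integrands may
    depend on time and starting point jointly. *)
Definition path_law (sz : (R * cE)%type) : set path_space -> \bar R :=
  fun A => P sz.2 A.

Section path_law_measure.
Variable sz : (R * cE)%type.
Let path_law0 : path_law sz set0 = 0. Proof. by rewrite /path_law measure0. Qed.
Let path_law_ge0 A : 0 <= path_law sz A. Proof. exact: measure_ge0. Qed.
Let path_law_sigma_additive : semi_sigma_additive (path_law sz).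
Proof.
have mid (B : set path_space) : measurable B -> measurable (B : set Omega).
  by move=> mB; rewrite -[X in measurable X]setTI; exact: measurable_id_path.
move=> F mF tF mUF; apply: measure_semi_sigma_additive => //.
  by move=> n; exact: mid.
exact: mid.
Qed.
HB.instance Definition _ := isMeasure.Build _ _ _ (path_law sz)
  path_law0 path_law_ge0 path_law_sigma_additive.
End path_law_measure.

Definition path_kernel (sz : (R * cE)%type) : {measure set path_space -> \bar R} :=
  path_law sz.

Let measurable_path_kernel (U : set path_space) : measurable U ->
  measurable_fun setT (path_kernel ^~ U).
Proof.
move=> mU; apply: (measurableT_comp (f := fun z : cE => P z U)); last exact: measurable_snd.
exact: rp_P_borel.
Qed.
HB.instance Definition _ := isKernel.Build _ _ _ _ R path_kernel measurable_path_kernel.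
Let path_kernelT sz : path_kernel sz setT = 1.
Proof. exact: probability_setT. Qed.
HB.instance Definition _ := Kernel_isProbability.Build _ _ _ _ R path_kernel path_kernelT.

(** Pushing [P z] forward along the identity onto [path_space] does not change the integral and
    makes it a kernel integral. *)
Lemma measurable_expectation (F : R * Omega -> \bar R) :
  (forall p, 0 <= F p) ->
  measurable_fun setT (F : R * path_space -> \bar R) ->
  measurable_fun setT (fun p : R * cE => \int[P p.2]_w F (p.1, w)).
Proof.
move=> F0 mF.
have -> : (fun p : R * cE => \int[P p.2]_w F (p.1, w)) =
    (fun p => \int[path_kernel p]_w F (p.1, w)).
  apply/funext => p.
  have := @ge0_integral_pushforward _ _ _ _ _ _ measurable_id_path (P p.2) setT
     (fun w => F (p.1, w)).
  rewrite preimage_setT => <- //.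
  by apply: (measurableT_comp mF).
apply: (measurable_fun_integral_finite_kernel (fun q : (R * cE) * path_space => F (q.1.1, q.2))) => //.
apply: (measurableT_comp mF); apply: measurable_fun_pair => //.
by apply: measurableT_comp => //; exact: measurable_fst.
Qed.

End path_space.

Section disintegration.
Import HBNNSimple.
Context (R : realType) d1 d2 d3 (O1 : measurableType d1) (O2 : measurableType d2)
  (T : measurableType d3).

Lemma integral_nnsfun_comp (d : measure_display) (O : measurableType d)
    (m : {measure set O -> \bar R}) (D : set O) (Y : O -> T) (h : {nnsfun T >-> R}) :
  measurable D -> measurable_fun setT Y ->
  \int[m]_(v in D) (h (Y v))%:E =
  \sum_(r \in range h) (r%:E * m (Y @^-1` (h @^-1` [set r]) `&` D)).
Proof.
move=> mD mY.
have mYr r : measurable (Y @^-1` (h @^-1` [set r])).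
  by rewrite -[X in measurable X]setTI; exact: mY.
transitivity (\int[m]_(v in D) (\sum_(r \in range h)
    (r%:E * (\1_(Y @^-1` (h @^-1` [set r])) v)%:E))).
  by apply: eq_integral => v _; rewrite fimfunE -fsumEFin.
rewrite ge0_integral_fsum//.
- apply: eq_fsbigr => r /set_mem[y _ <-].
  rewrite ge0_integralZl//; [by rewrite integral_indic| |by rewrite lee_fin].
  by apply/measurable_EFinP; exact: measurable_indic.
- move=> r; apply: measurable_funeM; apply/measurable_EFinP.
  exact: measurable_indic.
- by move=> r v _; exact: (nnfun_muleindic_ge0 h r (Y v)).
Qed.

Lemma ge0_integral_disintegration (Q : {measure set O1 -> \bar R})
    (k : O1 -> {measure set O2 -> \bar R}) (L : set O1) (Y1 : O1 -> T) (Y2 : O2 -> T)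
    (f : T -> \bar R) :
  measurable L -> measurable_fun setT Y1 -> measurable_fun setT Y2 ->
  (forall A, measurable A -> measurable_fun setT (fun w => k w (Y2 @^-1` A))) ->
  (forall A, measurable A -> \int[Q]_(w in L) k w (Y2 @^-1` A) = Q (Y1 @^-1` A `&` L)) ->
  measurable_fun setT f -> (forall y, 0 <= f y) ->
  \int[Q]_(w in L) \int[k w]_v f (Y2 v) = \int[Q]_(w in L) f (Y1 w).
Proof.
move=> mL mY1 mY2 mk kQ mf f0.
pose h := nnsfun_approx measurableT mf.
have hf y : (h n y)%:E @[n --> \oo] --> f y by exact: cvg_nnsfun_approx.
have hnd y m n : (m <= n)%N -> (h m y <= h n y)%R.
  by move=> mn; apply/lefP/nd_nnsfun_approx.
have mh2 n : measurable_fun setT (fun v => (h n (Y2 v))%:E).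
  by apply/measurable_EFinP; exact: measurableT_comp.
have mh1 n : measurable_fun setT (fun v => (h n (Y1 v))%:E).
  by apply/measurable_EFinP; exact: measurableT_comp.
have khE n w : \int[k w]_v (h n (Y2 v))%:E = \sum_(r \in range (h n))
    (r%:E * k w (Y2 @^-1` (h n @^-1` [set r]))).
  rewrite integral_nnsfun_comp//; apply: eq_fsbigr => r _.
  by rewrite setIT.
have mkr n r : measurable_fun setT
    (fun w => r%:E * k w (Y2 @^-1` (h n @^-1` [set r]))).
  by apply: measurable_funeM; exact: mk.
have mkh n : measurable_fun setT (fun w => \int[k w]_v (h n (Y2 v))%:E).
  apply: (eq_measurable_fun (fun w => \sum_(r \in range (h n))
    (r%:E * k w (Y2 @^-1` (h n @^-1` [set r]))))).
    by move=> w _; rewrite khE.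
  exact: emeasurable_fsum.
have simpleE n : \int[Q]_(w in L) \int[k w]_v (h n (Y2 v))%:E =
    \int[Q]_(w in L) (h n (Y1 w))%:E.
  rewrite integral_nnsfun_comp//.
  under eq_integral do rewrite khE.
  rewrite ge0_integral_fsum//.
  - apply: eq_fsbigr => r /set_mem[y _ <-].
    rewrite ge0_integralZl//; [by rewrite kQ| |by rewrite lee_fin].
    by apply: measurable_funTS; exact: mk.
  - by move=> r; apply: measurable_funTS; exact: mkr.
  (* A negative level r is not attained by [h n], so its term vanishes. *)
  - move=> r w _; have [r0|r0] := leP 0%R r; first by rewrite mule_ge0.
    by rewrite preimage_nnfun0// preimage_set0 measure0 mule0.
have RHSE : \int[Q]_(w in L) f (Y1 w) = limn (fun n => \int[Q]_(w in L) (h n (Y1 w))%:E).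
  rewrite -monotone_convergence//.
  - by apply: eq_integral => w _; apply/esym/cvg_lim => //; exact: hf.
  - by move=> n; exact: measurable_funTS.
  - by move=> n w _; rewrite lee_fin.
  - by move=> w _ m n mn; rewrite lee_fin hnd.
have innerE w : \int[k w]_v f (Y2 v) = limn (fun n => \int[k w]_v (h n (Y2 v))%:E).
  rewrite -monotone_convergence//.
  - by apply: eq_integral => v _; apply/esym/cvg_lim => //; exact: hf.
  - by move=> n v _; rewrite lee_fin.
  - by move=> v _ m n mn; rewrite lee_fin hnd.
under eq_integral do rewrite innerE.
rewrite monotone_convergence//.
- by rewrite RHSE; congr (limn _); apply/funext => n; exact: simpleE.
- by move=> n; exact: measurable_funTS.
- by move=> n w _; apply: integral_ge0 => v _; rewrite lee_fin.
- move=> w _ m n mn; apply: ge0_le_integral => //.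
  + by move=> v _; rewrite lee_fin.
  + by move=> v _; rewrite lee_fin hnd.
Qed.

End disintegration.

Section strong_markov.
Context (R : realType) (E : ptopologicalType) (d : measure_display)
  (Omega : measurableType d) (M : right_process R E Omega).
Hypothesis hausdorffE : hausdorff_space E.
Hypothesis borelE : borel_generated_by_continuous R E.
Local Notation X := (rp_X M).
Local Notation P := (rp_P M).
Local Notation F := (rp_filtration M).
Local Notation cE := (borel (cemetery E)).

Lemma measurable_cemetery_point (z : cE) : measurable [set z].
Proof.
case: z => [x|]; last exact: measurable_None.
apply: cemetery_set_measurable; rewrite [X in measurable X](_ : _ = [set x]).
  rewrite -[X in measurable X]setCK; apply: measurableC; apply: sub_sigma_algebra.
  rewrite openC; apply: accessible_closed_set1; exact: hausdorff_accessible.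
by apply/seteqP; split=> y /=; [case|move->].
Qed.

Lemma initial_law_dirac (z : cE) : initial_law P (\d_z : probability _ R) (P z).
Proof.
move=> A mA; rewrite integral_dirac_point//; first exact: measurable_cemetery_point.
exact: fin_num_measure.
Qed.

Lemma joint_measurable_X :
  measurable_fun setT (fun p : R * Omega => X (Num.max p.1 0%R) p.2 : cE).
Proof.
exact: joint_measurable borelE (@measurable_X _ _ _ _ M)
  (@rp_right_continuous _ _ _ _ M).
Qed.

Lemma joint_measurable_X_path :
  measurable_fun setT (fun p : R * path_space M => X (Num.max p.1 0%R) p.2 : cE).
Proof.
exact: (@joint_measurable _ _ _ (path_space M)) borelE
  (@measurable_X_path _ _ _ _ M) (@rp_right_continuous _ _ _ _ M).
Qed.

Lemma measurable_stopping_time tau : stopping_time F tau ->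
  measurable_fun setT tau.
Proof.
move=> [tau0 tauF]; apply: (measurability _ (ErealGenOInfty.measurableE R)).
move=> _ [_ [t ->] <-]; rewrite setTI.
rewrite [X in measurable X](_ : _ = ~` [set w | tau w <= t%:E]); last first.
  by apply/seteqP; split=> w /=; rewrite in_itv/= andbT ltNge => /negP.
apply: measurableC; have [t0|t0] := leP 0%R t.
  have [_ + _ _] := rp_filtrationP M; apply; first exact: t0.
  exact: tauF.
rewrite [X in measurable X](_ : _ = set0)//; apply/seteqP; split=> // w /=.
by move=> /(le_trans (tau0 w)); rewrite lee_fin leNgt t0.
Qed.

Lemma measurable_sample (tau : Omega -> \bar R) : (forall w, 0 <= tau w) ->
  measurable_fun setT tau -> measurable_fun setT (sample X tau : Omega -> cE).
Proof.
move=> tau0 mtau.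
have -> : sample X tau = (fun w => if tau w == +oo then None else
    X (Num.max (fine (tau w)) 0%R) w).
  apply/funext => w; rewrite /sample; move: (tau0 w); case: (tau w) => //= t.
  by rewrite lee_fin => t0; rewrite max_l.
apply: measurable_fun_ifT.
- apply: (measurable_fun_bool true); rewrite setTI.
  rewrite [X in measurable X](_ : _ = tau @^-1` [set +oo]).
    by rewrite -[X in measurable X]setTI; apply: mtau => //; exact: emeasurable_set1.
  by apply/seteqP; split=> w /= /eqP.
- exact: measurable_cst.
- have mp : measurable_fun setT (fun w => (fine (tau w), w)).
    by apply: measurable_fun_pair => //; exact: measurableT_comp.
  exact: measurableT_comp joint_measurable_X mp.
Qed.

(** [rp_strong] for the Dirac law at z gives the case of indicators [f]; the conditional probability
    it provides may be replaced by the kernel because they agree almost surely. *)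
Lemma strong_markov (z : cE) tau t (f : cE -> \bar R) (L : set Omega) :
  stopping_time F tau -> (0 <= t)%R -> stopped_sigma_algebra F tau L ->
  measurable_fun setT f -> (forall y, 0 <= f y) ->
  \int[P z]_(w in L) \int[P (sample X tau w)]_v f (X t v) =
  \int[P z]_(w in L) f (sample X (fun w' => tau w' + t%:E) w).
Proof.
move=> st t0 FL mf f0; have mtau := measurable_stopping_time st.
have [mL _] := FL; have tau0 := st.1.
have mS : measurable_fun setT (sample X tau : Omega -> cE) by exact: measurable_sample.
have mSt : measurable_fun setT (sample X (fun w' => tau w' + t%:E) : Omega -> cE).
  apply: measurable_sample; last exact: emeasurable_funD.
  by move=> w; rewrite adde_ge0.
have mk (A : set cE) : measurable A ->
    measurable_fun setT (fun w => P (sample X tau w) (X t @^-1` A)).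
  move=> mA; apply: (measurableT_comp (f := fun y : cE => P y (X t @^-1` A))) => //.
  by apply: rp_P_borel; apply: sub_sigma_algebra; exists t; split => //; exists A.
have := (@ge0_integral_disintegration R _ _ _ Omega Omega cE (P z)
  (fun w => P (sample X tau w)) L (sample X (fun w' => tau w' + t%:E)) (X t) f mL mSt (measurable_X M t0) mk).
move=> h; apply: h => //.
move=> A mA.
have [Y [YF Yint YE Yae]] := rp_strong (initial_law_dirac z) st t0 mA.
transitivity (\int[P z]_(w in L) Y w); last exact: YE.
apply: ae_eq_integral => //.
- by apply: measurable_funTS; exact: mk.
- by apply: measurable_funTS; exact: measurable_int Yint.
- by apply: filterS Yae => w + _; exact.
Qed.

End strong_markov.

(** * Potentials *)

Section half_line_integrals.
Context (R : realType).
Local Notation leb := (@lebesgue_measure R).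

Lemma lebesgue_measure_shift (t : R) (A : set R) : measurable A ->
  leb ((fun s => (t + s)%R) @^-1` A) = leb A.
Proof.
move=> mA; have mt : measurable_fun setT (fun s : measurableTypeR R => (t + s)%R : measurableTypeR R).
  by apply: (@measurable_funD _ _ R setT (cst t) id).
pose T : {mfun measurableTypeR R >-> measurableTypeR R} :=
  HB.pack (fun s : measurableTypeR R => (t + s)%R : measurableTypeR R)
    (isMeasurableFun.Build _ _ _ _ _ mt).
apply/esym.
have := @lebesgue_measure_unique R (pushforward leb T) _ A mA; apply.
move=> _ [[a b] _ <-] /=; rewrite /pushforward /=.
rewrite [X in _ = leb X](_ : _ = `](a - t)%R, (b - t)%R]%classic).
  rewrite !lebesgue_measure_itv/= !lte_fin ltrD2r; case: ifP => // _.
  by rewrite -!EFinB opprB addrA subrK.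
by apply/seteqP; split=> s /=; rewrite !in_itv/= ltrBlDl lerBrDl.
Qed.

Lemma integral_shift (t : R) (D : set R) (f : R -> \bar R) :
  measurable D -> measurable_fun D f -> (forall s, 0 <= f s) ->
  \int[leb]_(s in (fun s => (t + s)%R) @^-1` D) f (t + s)%R =
  \int[leb]_(s in D) f s.
Proof.
move=> mD mf f0.
have mt : measurable_fun setT (fun s : measurableTypeR R => (t + s)%R : measurableTypeR R).
  by apply: (@measurable_funD _ _ R setT (cst t) id).
rewrite -[LHS]/(\int[leb]_(s in (fun s => (t + s)%R) @^-1` D) (f \o (fun s => (t + s)%R)) s).
rewrite -(@ge0_integral_pushforward _ _ _ _ _ _ mt leb D f)//.
apply: eq_measure_integral => A mA _; rewrite /pushforward.
exact: lebesgue_measure_shift.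
Qed.

Lemma integral_half_line_shift (t : R) (f : R -> \bar R) :
  measurable_fun setT f -> (forall s, 0 <= f s) ->
  \int[leb]_(s in `[0%R, +oo[) f (t + s)%R = \int[leb]_(s in `[t, +oo[) f s.
Proof.
move=> mf f0; rewrite -(@integral_shift t `[t, +oo[%classic f)//; last exact: measurable_funTS.
congr integral.
by apply/seteqP; split=> s /=; rewrite !in_itv/= !andbT lerDl.
Qed.

End half_line_integrals.

Section potential.
Context (R : realType) (E : ptopologicalType) (d : measure_display)
  (Omega : measurableType d) (M : right_process R E Omega).
Hypothesis hausdorffE : hausdorff_space E.
Hypothesis borelE : borel_generated_by_continuous R E.
Local Notation X := (rp_X M).
Local Notation P := (rp_P M).
Local Notation F := (rp_filtration M).
Local Notation cE := (borel (cemetery E)).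
Local Notation leb := (@lebesgue_measure R).

Section potential_of.
Variable g : cE -> \bar R.
Hypothesis g0 : forall y, 0 <= g y.
Hypothesis mg : measurable_fun setT g.

(** At a = 0 this is the potential Ug of [g]. *)
Definition tail_potential (a : R) (z : cE) : \bar R :=
  \int[P z]_w \int[leb]_(s in `[a, +oo[) g (X s w).

(** The integrand of [tail_potential] extended by 0 to all real times, so that Fubini-Tonelli
    applies on the whole product. *)
Definition occ (a : R) (p : R * Omega) : \bar R :=
  if (a <= p.1)%R then g (X (Num.max p.1 0%R) p.2) else 0.

Lemma occ_ge0 a p : 0 <= occ a p.
Proof. by rewrite /occ; case: ifP. Qed.

Let half_lineE (a : R) (f h : R -> \bar R) :
  (forall s, (a <= s)%R -> f s = h s) ->
  \int[leb]_(s in `[a, +oo[) f s = \int[leb]_s (if (a <= s)%R then h s else 0).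
Proof.
move=> fh; rewrite integral_mkcond; apply: eq_integral => s _.
rewrite /patch; case: ifPn => [|/negP]; rewrite inE/= in_itv/= andbT.
  by move=> le_as; rewrite le_as fh.
by move=> /negP/negbTE ->.
Qed.

Lemma integral_occ a w : (0 <= a)%R ->
  \int[leb]_(s in `[a, +oo[) g (X s w) = \int[leb]_s occ a (s, w).
Proof.
move=> a0; apply: half_lineE => s le_as.
by rewrite max_l// (le_trans a0).
Qed.

Let measurable_from (a : R) d' (T : measurableType d') (f : R * T -> \bar R) :
  measurable_fun setT f ->
  measurable_fun setT (fun p => if (a <= p.1)%R then f p else 0).
Proof.
move=> mf; apply: measurable_fun_ifT => //.
by apply: measurable_fun_ler => //; exact: measurable_fst.
Qed.

Lemma measurable_occ a : measurable_fun setT (occ a).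
Proof.
apply: measurable_from; apply: (measurableT_comp mg).
exact: joint_measurable_X.
Qed.

Lemma measurable_occ_path a :
  measurable_fun setT (occ a : R * path_space M -> \bar R).
Proof.
apply: measurable_from; apply: (measurableT_comp mg).
exact: joint_measurable_X_path.
Qed.

Lemma measurable_integral_occ a : (0 <= a)%R ->
  measurable_fun setT (fun w => \int[leb]_(s in `[a, +oo[) g (X s w)).
Proof.
move=> a0; rewrite (_ : (fun _ => _) = fun w => \int[leb]_s occ a (s, w)).
  exact: (measurable_fun_fubini_tonelli_G (m1 := leb) (occ a) (measurable_occ a) (occ_ge0 a)).
by apply/funext => w; rewrite integral_occ.
Qed.

(** For s >= max(a, 0) this is p_s g(z), the density in time of the potential. *)
Definition mean_occ a (p : R * cE) := \int[P p.2]_w occ a (p.1, w).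

Lemma mean_occ_ge0 a p : 0 <= mean_occ a p.
Proof. by apply: integral_ge0 => w _; exact: occ_ge0. Qed.

Lemma measurable_mean_occ a : measurable_fun setT (mean_occ a).
Proof.
exact: (measurable_expectation (occ_ge0 a) (measurable_occ_path a)).
Qed.

Lemma tail_mean_occ a z : (0 <= a)%R ->
  tail_potential a z = \int[leb]_s mean_occ a (s, z).
Proof.
move=> a0; rewrite /tail_potential.
under eq_integral do rewrite integral_occ//.
exact: esym (fubini_tonelli (m1 := leb) (m2 := P z) (occ a) (measurable_occ a) (occ_ge0 a)).
Qed.

Lemma tail_potentialE a z : (0 <= a)%R ->
  tail_potential a z = \int[leb]_(s in `[a, +oo[) \int[P z]_w g (X s w).
Proof.
move=> a0; rewrite tail_mean_occ//.
rewrite (@half_lineE a _ (fun s => \int[P z]_w g (X (Num.max s 0%R) w))).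
  apply: eq_integral => s _; rewrite /mean_occ /occ /=; case: ifP => // _.
  by rewrite integral0.
by move=> s le_as; rewrite max_l// (le_trans a0).
Qed.

Lemma measurable_tail_potential a : (0 <= a)%R ->
  measurable_fun setT (tail_potential a).
Proof.
move=> a0; rewrite (_ : tail_potential a = fun z => \int[leb]_s mean_occ a (s, z)).
  apply: (measurable_fun_fubini_tonelli_G (m1 := leb) (mean_occ a) (measurable_mean_occ a)).
  by move=> p; exact: mean_occ_ge0.
by apply/funext => z; exact: tail_mean_occ.
Qed.

(** The strong Markov property at each deterministic lag s after [tau], integrated over s >= 0 and
    exchanged with the expectation. The measurability claim comes out of the same Fubini
    argument. *)
Lemma tail_potential_strong_markov (z : cE) tau : g None = 0 ->
  stopping_time F tau ->
  measurable_fun setT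
    (fun w => if tau w is t%:E then \int[leb]_(s in `[t, +oo[) g (X s w) else 0) /\
  \int[P z]_w tail_potential 0 (sample X tau w) =
  \int[P z]_w (if tau w is t%:E then \int[leb]_(s in `[t, +oo[) g (X s w) else 0).
Proof.
move=> gN st; have [tau0 _] := st.
have mtau := measurable_stopping_time st.
have mS : measurable_fun setT (sample X tau : Omega -> cE) by exact: measurable_sample.
pose H (p : R * Omega) : \bar R :=
  if (0 <= p.1)%R then
    if tau p.2 == +oo then 0 else g (X (Num.max (fine (tau p.2) + p.1)%R 0%R) p.2)
  else 0.
have mH : measurable_fun setT H.
  apply: measurable_from; apply: measurable_fun_ifT => //.
    apply: (measurable_fun_bool true); rewrite setTI.
    rewrite [X in measurable X](_ : _ = (tau \o snd) @^-1` [set +oo]).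
      have mts : measurable_fun setT (tau \o @snd R Omega).
        by apply: measurableT_comp => //; exact: measurable_snd.
      by rewrite -[X in measurable X]setTI; apply: mts => //; exact: emeasurable_set1.
    by apply/seteqP; split=> w /= /eqP.
  apply: (measurableT_comp mg).
  have mp : measurable_fun setT (fun p : R * Omega => ((fine (tau p.2) + p.1)%R, p.2)).
    apply: measurable_fun_pair; last exact: measurable_snd.
    apply: measurable_funD; last exact: measurable_fst.
    by apply: measurableT_comp => //; apply: measurableT_comp => //; exact: measurable_snd.
  exact: measurableT_comp (joint_measurable_X M borelE) mp.
have H0 p : 0 <= H p by rewrite /H; case: ifP => // _; case: ifP.
(* Where [tau] is infinite the sample is the cemetery, and [g None = 0] matches the zero branch of
   [H]. *)
have sampleH s w : (0 <= s)%R -> g (sample X (fun w' => tau w' + s%:E) w) = H (s, w).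
  move=> s0; rewrite /sample /H /= s0; move: (tau0 w).
  case: (tau w) => //= t; rewrite lee_fin => t0.
  by rewrite max_l// addr_ge0.
have HE w : \int[leb]_s H (s, w) =
    if tau w is t%:E then \int[leb]_(s in `[t, +oo[) g (X s w) else 0.
  rewrite /H /=; move: (tau0 w).
  case: (tau w) => //= [t|_]; last by rewrite integral0_eq// => s _; case: ifP.
  rewrite lee_fin => t0.
  pose k (s : R) := if (0 <= s)%R then g (X (Num.max s 0%R) w) else 0.
  have mk : measurable_fun setT k.
  have := measurableT_comp (measurable_occ 0) (measurable_fun_pair (@measurable_id _ _ _) (@measurable_cst _ _ _ _ setT w)).
  exact.
  have k0 s : 0 <= k s by rewrite /k; case: ifP.
  transitivity (\int[leb]_(s in `[0%R, +oo[) k (t + s)%R).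
  rewrite (@half_lineE 0 _ (fun s => g (X (Num.max (t + s)%R 0%R) w)))//.
  by move=> s s0; rewrite /k addr_ge0.
  rewrite integral_half_line_shift//; apply: eq_integral => s.
  rewrite inE/= in_itv/= andbT => ts; rewrite /k.
  by rewrite (le_trans t0 ts) max_l// (le_trans t0).
rewrite -(_ : (fun w => \int[leb]_s H (s, w)) = (fun w =>
    if tau w is t%:E then \int[leb]_(s in `[t, +oo[) g (X s w) else 0)); last exact/funext.
split; first exact: (measurable_fun_fubini_tonelli_G (m1 := leb) H mH H0).
under eq_integral do rewrite tail_mean_occ//.
rewrite -(@fubini_tonelli _ _ _ _ _ leb (P z) (fun p => mean_occ 0 (p.1, sample X tau p.2))); last 2 first.
- apply: (measurableT_comp (measurable_mean_occ 0)).
  apply: measurable_fun_pair; first exact: measurable_fst.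
  by apply: (measurableT_comp mS); exact: measurable_snd.
- by move=> p; exact: mean_occ_ge0.
transitivity (\int[leb]_s \int[P z]_w H (s, w)).
  apply: eq_integral => s _ /=; have [s0|s0] := leP 0%R s; last first.
    rewrite /mean_occ /occ /H /= leNgt s0 /= integral0.
    by rewrite integral0_eq// => w _; rewrite integral0.
  under [RHS]eq_integral do rewrite -sampleH//.
  rewrite -(strong_markov hausdorffE borelE z st s0 _ mg g0).
    rewrite /mean_occ /occ /= s0; apply: eq_integral => w _.
    by apply: eq_integral => v _; rewrite max_l.
  split=> // t t0; rewrite setTI; exact: st.2.
exact: (fubini_tonelli (m1 := leb) (m2 := P z) H mH H0).
Qed.

(** Counting only from [tau] on discards the nonnegative contribution of the times between a and
    [tau]. *)
Lemma tail_potential_sample_le (z : cE) tau a : g None = 0 -> (0 <= a)%R ->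
  stopping_time F tau -> (forall w, a%:E <= tau w) ->
  \int[P z]_w tail_potential 0 (sample X tau w) <= tail_potential a z.
Proof.
move=> gN a0 st atau; have [mI ->] := tail_potential_strong_markov z gN st.
have le_a t w : (a <= t)%R ->
    \int[leb]_(s in `[t, +oo[) g (X s w) <= \int[leb]_(s in `[a, +oo[) g (X s w).
  move=> le_at; rewrite !integral_occ// ?(le_trans a0)//.
  have mw : measurable_fun setT (fun s : R => (s, w)) by exact: measurable_fun_pair.
  apply: ge0_le_integral => //.
  - by move=> s _; exact: occ_ge0.
  - exact: measurableT_comp (measurable_occ t) mw.
  - exact: measurableT_comp (measurable_occ a) mw.
  - by move=> s _; rewrite /occ /=; case: ifP => [ts|_]; rewrite ?(le_trans le_at ts)// ; case: ifP.
apply: ge0_le_integral => //.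
- by move=> w _; case: (tau w) => // t; exact: integral_ge0.
- exact: measurable_integral_occ.
- move=> w _; move: (atau w); case: (tau w) => [t|_|//]; last exact: integral_ge0.
  by rewrite lee_fin => /le_a.
Qed.

End potential_of.
End potential.

(** * Stopping times and debuts *)

Section stopping_time_theory.
Context (R : realType) (E : ptopologicalType) (d : measure_display)
  (Omega : measurableType d) (M : right_process R E Omega).
Local Notation X := (rp_X M).
Local Notation F := (rp_filtration M).
Local Notation Ft t := (g_sigma_algebraType (F t)).

(** Turns membership in [F t] into measurability for a genuine measurable type, where the closure
    lemmas for measurable sets apply. *)
Lemma filtrationE t (A : set Omega) : (0 <= t)%R ->
  F t A <-> measurable (A : set (Ft t)).
Proof.
move=> t0; have [+ _ _ _] := rp_filtrationP M => /(_ t t0) /sigma_algebra_id FtE.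
by split; rewrite /measurable/= FtE.
Qed.

Lemma filtrationS s t : (0 <= s)%R -> (s <= t)%R -> F s `<=` F t.
Proof. by have [_ _ + _] := rp_filtrationP M; exact. Qed.

Lemma stopping_time_cst (a : R) : (0 <= a)%R ->
  stopping_time F (cst a%:E : Omega -> \bar R).
Proof.
move=> a0; split=> [w|t t0]; first by rewrite lee_fin.
apply/filtrationE => //; have [le_at|lt_ta] := leP a t.
  rewrite [X in measurable X](_ : _ = setT)//.
  by apply/seteqP; split=> // w _ /=; rewrite lee_fin.
rewrite [X in measurable X](_ : _ = set0)//.
by apply/seteqP; split=> // w /=; rewrite lee_fin leNgt lt_ta.
Qed.

Lemma stopping_time_sup (T : nat -> Omega -> \bar R) :
  (forall n, stopping_time F (T n)) ->
  stopping_time F (fun w => ereal_sup (range (T ^~ w))).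
Proof.
move=> st; split=> [w|t t0].
  by apply: le_trans ((st 0%N).1 w) _; apply: ereal_sup_ubound; exists 0%N.
apply/filtrationE => //.
rewrite [X in measurable X](_ : _ = \bigcap_n [set w | T n w <= t%:E]).
  by apply: bigcapT_measurable => n; apply/filtrationE => //; exact: (st n).2.
apply/seteqP; split=> w /= h.
  by move=> n _ /=; apply: le_trans h; apply: ereal_sup_ubound; exists n.
by apply: ge_ereal_sup => _ [n _ <-]; exact: h.
Qed.

Lemma stopping_time_lt (T : Omega -> \bar R) t : stopping_time F T -> (0 <= t)%R ->
  F t [set w | T w < t%:E].
Proof.
move=> [T0 TF] t0; apply/filtrationE => //.
rewrite [X in measurable X](_ : _ =
    \bigcup_n [set w | T w <= (t - n.+1%:R^-1)%:E]).
  apply: bigcupT_measurable => n; have [h|h] := leP 0%R (t - n.+1%:R^-1)%R.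
    apply/filtrationE => //; apply: (filtrationS h); last exact: TF.
    by rewrite lerBlDr lerDl.
  rewrite [X in measurable X](_ : _ = set0)//; apply/seteqP; split=> // w /=.
  by move=> /(le_trans (T0 w)); rewrite lee_fin leNgt h.
apply/seteqP; split=> w /=; last first.
  move=> [n _ /= /le_lt_trans]; apply; rewrite lte_fin.
  by rewrite ltrBlDr ltrDl invr_gt0.
move: (T0 w); case Tw : (T w) => [r| |]// _; rewrite lte_fin => rt.
exists (Num.truncn (t - r)^-1) => //; rewrite /mkset Tw lee_fin lerBrDr -lerBrDl.
by rewrite ltW// invf_plt ?posrE ?subr_gt0// truncnS_gt.
Qed.

(* The first entrance into G strictly after T, read along the rationals: by
   right continuity this loses nothing when G is open. *)
Definition entrance_after (G : set (cemetery E)) (T : Omega -> \bar R) (w : Omega) : \bar R :=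
  ereal_inf [set (ratr q)%:E | q in [set q : rat |
     [/\ (0 <= ratr q :> R)%R, T w < (ratr q)%:E & G (X (ratr q) w)]]].

Lemma entrance_after_ge G T w : T w <= entrance_after G T w.
Proof. by apply: le_ereal_inf_tmp => _ [q [_ /ltW Tq _] <-]. Qed.

Lemma open_right (G : set (cemetery E)) w s : open G -> (0 <= s)%R ->
  G (X s w) -> exists2 e : R, (0 < e)%R &
    forall u, (s < u)%R -> (u < s + e)%R -> G (X u w).
Proof.
move=> oG s0 Gs; have := @rp_right_continuous _ _ _ _ M w s s0 G.
move=> /(_ (open_nbhs_nbhs (conj oG Gs))) [e /= e0 eP].
exists e => // u su use; apply: (eP u) => //=.
by rewrite distrC ger0_norm ?subr_ge0 1?ltW// ltrBlDl.
Qed.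

(** By right continuity the path is still in [G] just after s, hence at rationals arbitrarily close
    to s and strictly later than [T w], even if [T w] equals s. *)
Lemma entrance_after_le G T w s : open G -> (forall w, 0 <= T w) ->
  T w <= s%:E -> G (X s w) -> entrance_after G T w <= s%:E.
Proof.
move=> oG T0 Ts Gs.
have s0 : (0 <= s)%R by rewrite -lee_fin (le_trans (T0 w)).
have [e e0 eP] := open_right oG s0 Gs.
apply/lee_addgt0Pr => e' e'0.
have : (s < s + Num.min e e')%R by rewrite ltrDl lt_min e0.
move=> /rat_in_itvoo[q]; rewrite in_itv/= => /andP[sq qe].
apply: (@le_trans _ _ (ratr q)%:E).
  apply: ereal_inf_lbound; exists q => //; split.
  - exact: le_trans (ltW sq).
  - by rewrite (le_lt_trans Ts)// lte_fin.
  - by apply: eP => //; rewrite (lt_le_trans qe)// lerD2l ge_min lexx.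
by rewrite -EFinD lee_fin (le_trans (ltW qe))// lerD2l ge_min lexx orbT.
Qed.

Lemma stopping_time_entrance_after (G : set (cemetery E)) T : open G ->
  stopping_time F T -> stopping_time F (entrance_after G T).
Proof.
move=> oG st; have [T0 _] := st; split=> [w|t t0].
  exact: le_trans (T0 w) (entrance_after_ge _ _ _).
have lt_meas s : (0 <= s)%R -> F s [set w | entrance_after G T w < s%:E].
  move=> s0; apply/filtrationE => //.
  pose I (q : rat) : set (Ft s) := [set w |
    [/\ (0 <= (ratr q : R) < s)%R, T w < (ratr q)%:E & G (X (ratr q) w)]].
  rewrite [X in measurable X](_ : _ = \bigcup_q I q).
    apply: bigcupT_measurable_rat => q.
    have [/andP[q0 qs]|qs] := boolP (0 <= (ratr q : R) < s)%R; last first.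
      rewrite [X in measurable X](_ : _ = set0)//.
      by apply/seteqP; split=> // w [qs']; rewrite qs' in qs.
    rewrite [X in measurable X](_ : _ =
        [set w | T w < (ratr q)%:E] `&` X (ratr q) @^-1` G).
      apply: measurableI; apply/filtrationE => //; apply: (filtrationS q0 (ltW qs)).
        exact: stopping_time_lt.
      by apply: rp_adapted => //; apply: sub_sigma_algebra.
    by apply/seteqP; split=> w; [case|move=> [Tq Gq]; split; rewrite ?q0].
  apply/seteqP; split=> w /=.
    move=> /ereal_inf_lt[_ [q [q0 Tq Gq] <-]]; rewrite lte_fin => qs.
    by exists q => //; split; rewrite ?q0.
  move=> [q _ [/andP[q0 qs] Tq Gq]]; apply: (@le_lt_trans _ _ (ratr q)%:E); last by rewrite lte_fin.
  by apply: ereal_inf_lbound; exists q.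
(* Right continuity of the filtration: strict inequalities at times decreasing to t, all at most s,
   place the event in [F s] for every s > t. *)
have [_ _ _ +] := rp_filtrationP M; apply => // s /= ts.
have s0 : (0 <= s)%R by rewrite (le_trans t0)// ltW.
apply/filtrationE => //.
rewrite [X in measurable X](_ : _ = \bigcap_n
    [set w | entrance_after G T w < (t + (s - t) / n.+1%:R)%:E]).
  apply: bigcapT_measurable => n; apply/filtrationE => //.
  have tn0 : (0 <= t + (s - t) / n.+1%:R)%R by rewrite addr_ge0// divr_ge0// subr_ge0 ltW.
  apply: (filtrationS tn0); last exact: lt_meas.
  by rewrite -lerBrDl ler_pdivrMr// ler_peMr ?ler1n// subr_ge0 ltW.
apply/seteqP; split=> w /= h.
  move=> n _ /=; rewrite (le_lt_trans h)// lte_fin ltrDl divr_gt0//.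
  by rewrite subr_gt0.
apply/lee_addgt0Pr => e e0.
have hn := h (Num.truncn ((s - t) / e)) I; apply: ltW (lt_le_trans hn _).
rewrite -EFinD lee_fin lerD2l ler_pdivrMr// -ler_pdivrMl// mulrC.
by rewrite ltW// truncnS_gt.
Qed.

Lemma entrance_after_gt G T w t e : T w = t%:E -> (0 < e)%R ->
  (forall u, (t < u)%R -> (u < t + e)%R -> ~ G (X u w)) ->
  T w < entrance_after G T w.
Proof.
move=> Tt e0 nG; rewrite Tt; apply: (@lt_le_trans _ _ (t + e)%:E).
  by rewrite lte_fin ltrDl.
apply: le_ereal_inf_tmp => _ [q [q0 Tq Gq] <-]; rewrite lee_fin leNgt; apply/negP => qte.
by apply: (nG (ratr q)) => //; rewrite -lte_fin -Tt.
Qed.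

End stopping_time_theory.

(** * Debuts of closed sets *)

Section closed_debut.
Context (R : realType) (E : ptopologicalType) (d : measure_display)
  (Omega : measurableType d) (M : right_process R E Omega).
Local Notation X := (rp_X M).
Local Notation P := (rp_P M).
Local Notation F := (rp_filtration M).
Local Notation cE := (borel (cemetery E)).

(** The strictly increasing bounded map [contract] gives stopping times, infinite values included, a
    finite expectation; the essential supremum is then found by maximising it. *)
Lemma measurable_contract : measurable_fun setT (@contract R).
Proof.
rewrite (_ : @contract R = fun x => if x == +oo then 1%R else
    if x == -oo then (-1)%R else (fine x / (1 + `|fine x|))%R); last first.
  by apply/funext => -[].
have mpt (y : \bar R) : measurable_fun setT (fun x : \bar R => x == y).
  apply: (measurable_fun_bool true); rewrite setTI.
  rewrite [X in measurable X](_ : _ = [set y]); first exact: emeasurable_set1.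
  by apply/seteqP; split=> x /= /eqP.
do 2 (apply: measurable_fun_ifT => //).
apply: measurable_funM => //.
have -> : (fun x : \bar R => (1 + `|fine x|)^-1%R) = (fun y : R => (1 + `|y|)^-1%R) \o fine by [].
apply: measurableT_comp => //; apply: continuous_measurable_fun => y.
apply: cvgV; first by rewrite gt_eqF// ltr_pwDl.
by apply: cvgD; [exact: cvg_cst|exact: norm_continuous].
Qed.

(* The essential supremum S of the stopping times lying below all visits to
   the closed set cannot be improved by entering a smaller neighbourhood, so
   it must itself be a visit almost surely. *)
Lemma closed_debut (z : cE) (rho : nat -> cemetery E -> R) (a : R) :
  (forall n, continuous (rho n)) -> (forall n y, (0 <= rho n y)%R) -> (0 <= a)%R ->
  exists T : Omega -> \bar R, [/\ stopping_time F T, forall w, a%:E <= T w,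
    forall w s, (a <= s)%R -> (forall n, rho n (X s w) = 0%R) -> T w <= s%:E
  & forall n, (P z).-negligible [set w | T w < +oo /\ rho n (sample X T w) != 0%R]].
Proof.
move=> crho rho0 a0.
pose good T := [/\ stopping_time F T, forall w, a%:E <= T w &
  forall w s, (a <= s)%R -> (forall n, rho n (X s w) = 0%R) -> T w <= s%:E].
have good_ge0 T w : good T -> 0 <= T w by move=> [_ aT _]; rewrite (le_trans _ (aT w))// lee_fin.
have good_sup (T : nat -> Omega -> \bar R) : (forall n, good (T n)) ->
    good (fun w => ereal_sup (range (T ^~ w))).
  move=> gT; split.
  - by apply: stopping_time_sup => n; case: (gT n).
  - move=> w; have [_ aT _] := gT 0%N; apply: (le_trans (aT w)).
    by apply: ereal_sup_ubound; exists 0%N.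
  - move=> w s le_as rs; apply: ge_ereal_sup => _ [n _ <-].
    by have [_ _] := gT n; exact.
(* Open neighbourhoods shrinking to the common zero set; finitely many functions at each stage keep
   them open. *)
pose G k : set (cemetery E) :=
  [set y | forall n, (n <= k)%N -> (rho n y < k.+1%:R^-1)%R].
have oG k : open (G k).
  have oL n (r : R) : open [set y | (rho n y < r)%R].
    rewrite (_ : [set y | _] = rho n @^-1` [set y | (y < r)%R])//.
    by move/continuousP : (crho n); apply; exact: open_lt.
  rewrite /G; elim: {1}k => [|m IH].
    rewrite (_ : mkset _ = [set y | (rho 0%N y < k.+1%:R^-1)%R])//.
    by apply/seteqP; split=> y /= h; [exact: h|move=> n; rewrite leqn0 => /eqP ->].
  rewrite (_ : mkset _ = [set y | forall n, (n <= m)%N -> (rho n y < k.+1%:R^-1)%R] `&`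
      [set y | (rho m.+1 y < k.+1%:R^-1)%R]); first exact: openI.
  apply/seteqP; split=> y /= => [h|[h hm] n].
    by split=> [n nm|]; apply: h => //; rewrite ltnW.
  by rewrite leq_eqVlt => /predU1P[->//|]; exact: h.
pose next T w := ereal_sup (range (fun k => entrance_after M (G k) T w)).
have next_good T : good T -> good (next T).
  move=> gT; apply: (good_sup (fun k => entrance_after M (G k) T)) => k.
  have [sT aT TP] := gT; split.
  - exact: stopping_time_entrance_after.
  - by move=> w; apply: (le_trans (aT w)); exact: entrance_after_ge.
  - move=> w s le_as rs; apply: entrance_after_le => //.
    + by move=> v; exact: good_ge0.
    + exact: TP.
    + by move=> n _; rewrite rs invr_gt0.
have next_ge T w : T w <= next T w.
  apply: (le_trans (entrance_after_ge M (G 0%N) T w)).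
  by apply: ereal_sup_ubound; exists 0%N.
(* If [rho n] is positive at time [T w], right continuity keeps the path out of [G k] for a while,
   for some k >= n with 1/(k+1) below that value. *)
have next_gt T w n : good T -> T w < +oo -> rho n (sample X T w) != 0%R -> T w < next T w.
  move=> gT; have := good_ge0 T w gT; rewrite /sample.
  case Tw : (T w) => [t| |]//; rewrite lee_fin => t0 _ rt.
  have rt0 : (0 < rho n (X t w))%R by rewrite lt_neqAle eq_sym rt rho0.
  pose k := maxn n (Num.truncn (rho n (X t w))^-1).
  have kP : (k.+1%:R^-1 < rho n (X t w))%R.
    rewrite invf_plt ?posrE//; apply: (lt_le_trans (truncnS_gt _)).
    by rewrite ler_nat ltnS leq_maxr.
  have oH : open [set y | (k.+1%:R^-1 < rho n y)%R].
    rewrite (_ : [set y | _] = rho n @^-1` [set y | (k.+1%:R^-1 < y)%R])//.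
    by move/continuousP : (crho n); apply; exact: open_gt.
  have [e e0 eP] := open_right oH t0 kP.
  rewrite -Tw; apply: (@lt_le_trans _ _ (entrance_after M (G k) T w)).
    apply: (entrance_after_gt Tw e0) => u tu ut /(_ n (leq_maxl _ _)).
    by apply/negP; rewrite -leNgt ltW//; exact: eP.
  by apply: ereal_sup_ubound; exists k.
have mgood T : good T -> measurable_fun setT T.
  by move=> [sT _ _]; exact (measurable_stopping_time sT).
pose c (T : Omega -> \bar R) w : \bar R := (contract (T w))%:E.
have mc T : good T -> measurable_fun setT (c T).
  move=> gT; apply/measurable_EFinP; apply: measurableT_comp; last exact: mgood.
  exact: measurable_contract.
have c0 T w : good T -> 0 <= c T w.
  by move=> gT; rewrite /c lee_fin -contract0 le_contract; exact: good_ge0.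
have c1 T w : c T w <= 1 by rewrite /c lee_fin; case/ler_normlP: (contract_le1 (T w)).
pose J T := \int[P z]_w c T w.
have I1 T : good T -> J T <= 1.
  move=> gT; rewrite -(probability_setT (P z)) -[leRHS]mul1e -integral_cst//.
  apply: ge0_le_integral => //; [by move=> w _; exact: c0|exact: mc].
have I_le T T' : good T -> good T' -> (forall w, T w <= T' w) -> J T <= J T'.
  move=> gT gT' TT'; apply: ge0_le_integral => //.
  - by move=> w _; exact: c0.
  - exact: mc.
  - exact: mc.
  - by move=> w _; rewrite /c lee_fin le_contract.
have gcst : good (cst a%:E).
  by split=> [||w s]; [exact: stopping_time_cst|by []|rewrite lee_fin].
pose S := ereal_sup [set J T | T in good].
have Sfin : S \is a fin_num.
  rewrite fin_numE; apply/andP; split.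
    rewrite gt_eqF// (@lt_le_trans _ _ 0)//.
    apply: (@le_trans _ _ (J (cst a%:E))).
      by apply: integral_ge0 => w _; exact: c0.
    by apply: ereal_sup_ubound; exists (cst a%:E).
  rewrite lt_eqF// (@le_lt_trans _ _ 1)// ?ltry//.
  by apply: ge_ereal_sup => _ [T gT <-]; exact: I1.
have /(fun h n => cid (h n)) TnP n : exists T, good T /\ S - n.+1%:R^-1%:E < J T.
  have [|_ [T gT <-] ST] := @ub_ereal_sup_adherent _ [set J T | T in good] n.+1%:R^-1%R _ Sfin.
    by rewrite invr_gt0.
  by exists T.
pose Tn n := sval (TnP n).
have gTn n : good (Tn n) := (svalP (TnP n)).1.
pose T w := ereal_sup (range (Tn ^~ w)).
have gT : good T by exact: good_sup.
have SI : S <= J T.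
  apply/lee_addgt0Pr => e e0.
  have [n ne] : exists n : nat, (n.+1%:R^-1 <= e)%R.
    exists (Num.truncn e^-1); rewrite ltW// invf_plt ?posrE//.
    by rewrite truncnS_gt.
  have [_] := svalP (TnP n); rewrite lteBlDr// => /ltW /le_trans; apply.
  apply: leeD; last by rewrite lee_fin.
  by apply: (I_le _ _ (gTn n) gT) => w; apply: ereal_sup_ubound; exists n.
have gN := next_good _ gT.
(* [next T] is again good, and [J T] is already maximal. *)
have IN : J (next T) = J T.
  apply/eqP; rewrite eq_le; apply/andP; split; last exact: I_le.
  by apply: le_trans SI; apply: ereal_sup_ubound; exists (next T).
have [sT aT TP] := gT; exists T; split => // n.
(* A nonnegative function with zero integral vanishes almost surely; by [next_gt] it is positive
   wherever [T] is finite without being a visit. *)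
pose D w : \bar R := (contract (next T w) - contract (T w))%:E.
have D0 w : 0 <= D w by rewrite /D lee_fin subr_ge0 le_contract.
have mD : measurable_fun setT D.
  apply/measurable_EFinP; apply: measurable_funB.
    exact/measurable_EFinP/(mc (next T)).
  exact/measurable_EFinP/(mc T).
have ID : \int[P z]_w D w = 0.
  have : J (next T) = J T + \int[P z]_w D w.
    rewrite -ge0_integralD//; [|by move=> w _; exact: c0|exact: mc].
    by apply: eq_integral => w _; rewrite /c /D -EFinD addrC subrK.
  have If : J T \is a fin_num.
    rewrite ge0_fin_numE; last by apply: integral_ge0 => w _; exact: c0.
    by rewrite (le_lt_trans (I1 _ gT))// ltry.
  rewrite IN => ITE; rewrite -[LHS](addeK (\int[P z]_w D w) If) [X in X - _]addeC.
  by rewrite -ITE subee.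
have : ae_eq (P z) setT D (cst 0).
  apply/ae_eq_integral_abs => //; rewrite -[RHS]ID.
  by apply: eq_integral => w _; rewrite gee0_abs.
move=> [N [mN N0 DN]]; exists N; split => //.
move=> w [Too rw]; apply: DN => /(_ Logic.I) /eqP.
by rewrite /D /cst eqe subr_eq0 gt_eqF// lt_contract (next_gt _ _ n).
Qed.

End closed_debut.

(** * Hitting probabilities and potentials *)

Section zero_sets.
Context (R : realType) (E : ptopologicalType).
Hypothesis borelE : borel_generated_by_continuous R E.

(** Closed sets in the form accepted by [closed_debut]; products and sums of absolute values make
    them a paving. *)
Definition zero_sets : set (set E) :=
  [set A | exists2 f : E -> R, continuous f & A = f @^-1` [set 0%R]].

Lemma zero_setsU A B : zero_sets A -> zero_sets B -> zero_sets (A `|` B).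
Proof.
move=> [f cf ->] [g cg ->]; exists (fun x => f x * g x)%R.
  by move=> x; apply: cvgM; [exact: cf|exact: cg].
apply/seteqP; split=> x /=; first by move=> [->|->]; rewrite ?mul0r ?mulr0.
by move/eqP; rewrite mulf_eq0 => /orP[] /eqP; [left|right].
Qed.

Lemma zero_setsI A B : zero_sets A -> zero_sets B -> zero_sets (A `&` B).
Proof.
move=> [f cf ->] [g cg ->]; exists (fun x => `|f x| + `|g x|)%R.
  by move=> x; apply: cvgD; apply: cvg_norm; [exact: cf|exact: cg].
apply/seteqP; split=> x /=; first by move=> [-> ->]; rewrite normr0 addr0.
by move/eqP; rewrite paddr_eq0// !normr_eq0 => /andP[/eqP ? /eqP ?].
Qed.

(** By [borelE] it suffices to treat preimages of half-lines under a continuous f: {f >= x} is the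
    zero set of max(x - f, 0), and {f < x} is a countable union of such sets. *)
Lemma borel_zero_sets_analytic (A : set (borel E)) : measurable A ->
  analytic zero_sets A.
Proof.
have anU := analytic_bigcup zero_setsU.
have ge_zero (f : E -> R) (r : R) : continuous f -> zero_sets [set x | (r <= f x)%R].
  move=> cf; exists (fun x => Num.max (r - f x) 0)%R.
    move=> x; apply: (@continuous_max _ _ (fun x => r - f x)%R (cst 0%R)); last exact: cst_continuous.
    by apply: cvgB; [exact: cvg_cst|exact: cf].
  apply/seteqP; split=> x /=; rewrite -subr_le0; first by move/max_r.
  by move=> <-; rewrite le_max lexx.
have zT : zero_sets setT.
  by exists (cst 0%R); [exact: cst_continuous|apply/seteqP; split].
have z0 : zero_sets set0.
  exists (cst 1%R); first exact: cst_continuous.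
  by apply/seteqP; split=> x //= /eqP; rewrite oner_eq0.
have sA := sigma_algebra_analytic zero_setsU zero_setsI (paving_analytic z0) (paving_analytic zT).
move=> mA; suff [] : analytic zero_sets A /\ analytic zero_sets (~` A) by [].
have {}mA : <<s @open E >> A by [].
move: mA; rewrite borelE; move: A; apply: smallest_sub => //.
move=> _ [f [cf [U oU ->]]].
have mU : <<s @RGenCInfty.G R >> U.
  have : (@ocitv R).-sigma.-measurable U by exact: open_measurable.
  by rewrite RGenCInfty.measurableE.
have sI := sigma_algebra_image f sA.
rewrite -[_ @^-1` U]setTI.
suff: image_set_system setT f
    [set A | analytic zero_sets A /\ analytic zero_sets (~` A)] U by [].
move: U mU {oU}; apply: smallest_sub; first exact: sI.
move=> _ [x ->]; rewrite /image_set_system/= setTI; split.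
  apply: paving_analytic; rewrite (_ : _ @^-1` _ = [set y | (x <= f y)%R]).
    exact: ge_zero.
  by apply/seteqP; split=> y /=; rewrite in_itv/= andbT.
rewrite [X in analytic _ X](_ : _ = \bigcup_n [set y | (- (x - n.+1%:R^-1) <= - f y)%R]).
  apply: anU => n; apply: paving_analytic; apply: (ge_zero (fun y => - f y)%R).
  by move=> y; apply: cvgN; exact: cf.
apply/seteqP; split=> y /=; rewrite in_itv/= andbT.
  move=> /negP; rewrite -ltNge => fx.
  exists (Num.truncn (x - f y)^-1) => //=.
  rewrite lerN2 lerBrDr -lerBrDl ltW// invf_plt ?posrE ?subr_gt0//.
  by rewrite truncnS_gt.
move=> [n _ /=]; rewrite lerN2 => h; apply/negP; rewrite -ltNge (le_lt_trans h)//.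
by rewrite ltrBlDr ltrDl invr_gt0.
Qed.

Lemma measurable_zero_set (f : E -> R) : continuous f ->
  measurable (f @^-1` [set 0%R] : set (borel E)).
Proof.
move=> cf; rewrite -[X in measurable X]setCK; apply: measurableC.
apply: sub_sigma_algebra; rewrite preimage_setC.
by move/continuousP : cf; apply; rewrite openC; exact: closed_eq.
Qed.

(** Capacitability once more, now for the paving of zero sets; continuity from above, for a finite
    measure, carries the bound to the intersection. *)
Lemma inner_regular_zero_sets (nu : {measure set (borel E) -> \bar R})
    (B : set (borel E)) (a : \bar R) :
  nu setT < +oo -> measurable B -> a < nu B ->
  exists rho : nat -> E -> R, [/\ forall n, continuous (rho n),
    forall n x, (0 <= rho n x)%R,
    \bigcap_n rho n @^-1` [set 0%R] `<=` B
  & a <= nu (\bigcap_n rho n @^-1` [set 0%R])].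
Proof.
move=> nuT mB aB.
have bigB : outer_gt nu a B.
  by move=> C mC BC; apply: (lt_le_trans aB); apply: le_measure; rewrite ?inE.
have [K [zK bigK Kd KB]] := capacitability (@outer_gtS _ _ _ nu a)
  (@outer_gt_bigcup _ _ _ nu a) (borel_zero_sets_analytic mB) bigB.
have /(fun h n => cid2 (h n)) fP := zK.
have KE n : K n = (fun x => `|s2val (fP n) x|)%R @^-1` [set 0%R].
  rewrite {1}(s2valP' (fP n)); apply/seteqP; split=> x /=; first by move->; rewrite normr0.
  exact: normr0_eq0.
have mK n : measurable (K n : set (borel E)).
  by have [f cf ->] := zK n; exact: measurable_zero_set.
exists (fun n x => `|s2val (fP n) x|)%R; split=> //.
- by move=> n x; apply: cvg_norm; exact: (s2valP (fP n)).
- by move=> x Kx; apply: KB => n _; rewrite KE; exact: Kx.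
have -> : \bigcap_n (fun x => `|s2val (fP n) x|)%R @^-1` [set 0%R] = \bigcap_n K n.
  by apply: eq_bigcapr => n _; rewrite -KE.
have cvgK : nu (K n) @[n --> \oo] --> nu (\bigcap_n K n).
  apply: nonincreasing_cvg_mu => //.
  - by apply: le_lt_trans nuT; apply: le_measure; rewrite ?inE.
  - exact: bigcapT_measurable.
  - by apply/nonincreasing_seqP => n; apply/subsetPset; exact: Kd.
rewrite -(cvg_lim _ cvgK)//; apply: lime_ge; first by apply/cvg_ex; eexists; exact: cvgK.
by apply: nearW => n; rewrite ltW//; exact: bigK (mK n) (@subset_refl _ _).
Qed.

End zero_sets.

Section hitting_bound.
Context (R : realType) (E : ptopologicalType) (d : measure_display)
  (Omega : measurableType d) (M : right_process R E Omega).
Hypothesis hausdorffE : hausdorff_space E.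
Hypothesis borelE : borel_generated_by_continuous R E.
Local Notation X := (rp_X M).
Local Notation P := (rp_P M).
Local Notation cE := (borel (cemetery E)).

(* The graph of the measurable selection r need not be that of a stopping
   time; it only serves to find a countable intersection of zero sets inside
   B that is visited almost as often as B. *)
Lemma hitting_bound (g : cE -> \bar R) (B : set (borel E)) (z : cE)
    (c k a b : R) :
  (forall y, 0 <= g y) -> measurable_fun setT g -> g None = 0 ->
  measurable B -> (0 < c)%R -> (0 <= k)%R ->
  (forall x, B x -> c%:E <= tail_potential M g 0 (Some x)) ->
  outer_gt (P z) a%:E [set w | exists2 s, (k <= s)%R & (@Some E @` B) (X s w)] ->
  (b < a)%R -> (c * b)%:E <= tail_potential M g k z.
Proof.
move=> g0 mg gN mB c0 k0 Bc bigB ba.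
pose A : set (R * Omega) := [set p | (k <= p.1)%R /\
  (@Some E @` B) (X (Num.max p.1 0%R) p.2)].
have mA : measurable A.
  rewrite [X in measurable X](_ : _ = (fst @^-1` `[k, +oo[%classic) `&`
      ((fun p => X (Num.max p.1 0%R) p.2) @^-1` (@Some E @` B))).
    apply: measurableI; rewrite -[X in measurable X]setTI.
      by apply: measurable_fst => //.
    by apply: (joint_measurable_X M borelE) => //; exact: measurable_image_Some.
  by apply/seteqP; split=> p /=; rewrite in_itv/= andbT.
have [|D [r [mD mr aD DA]]] := @measurable_section _ _ _ (P z) A a%:E mA.
  apply: outer_gtS bigB => w [s ks Bs]; exists (s, w) => //; split => //=.
  by rewrite max_l// (le_trans k0).
(* The selection is measurable on [D] only; outside [D] it is set to 0, a value that the restriction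
   to [D] in [nu_] ignores. *)
pose r' := (r \_ D)%R.
have mr' : measurable_fun setT r' by exact: (measurable_restrictT r mD).1 mr.
pose fromS (y : cE) : borel E := if y is Some x then x else point.
have mfromS : measurable_fun setT fromS by apply: measurable_cemetery; exact: measurable_id.
pose Y w : borel E := fromS (X (Num.max (r' w) 0%R) w).
have mY : measurable_fun setT Y.
  apply: (measurableT_comp mfromS).
  have mp : measurable_fun setT (fun w => (r' w, w)) by exact: measurable_fun_pair.
  exact: measurableT_comp (joint_measurable_X M borelE) mp.
have YP w : D w -> [/\ B (Y w), (k <= r w)%R & X (r w) w = Some (Y w)].
  move=> Dw; have [/= kr [x Bx xX]] := DA w Dw.
  have r'E : r' w = r w by rewrite /r' patchE mem_set.
  rewrite /Y r'E -xX /=; split => //.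
  by move: xX; rewrite max_l// (le_trans k0).
(* The law of the position at the selected time, restricted to [D]: a finite measure carried by [B],
   for which inner regularity provides the closed subset. *)
pose nu_ : {measure set (borel E) -> \bar R} := pushforward (mrestr (P z) mD) Y.
pose nu := nu_ mY.
have nuE (C : set (borel E)) : nu C = P z (Y @^-1` C `&` D) by [].
have DB : D `<=` Y @^-1` B by move=> w /YP[].
have nuB : nu B = P z D by rewrite nuE setIidr.
have [||rho [crho rho0 rhoB b_rho]] := @inner_regular_zero_sets _ _ borelE nu B b%:E _ mB.
- by rewrite nuE preimage_setT setTI ltey_eq fin_num_measure.
- by rewrite nuB (lt_le_trans _ aD).
(* The value 1 at the cemetery keeps it out of the closed set. *)
pose rh n (y : cemetery E) : R := if y is Some x then rho n x else 1%R.
have [] := @closed_debut _ _ _ _ M z rh k.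
- by move=> n; apply: continuous_cemetery; exact: crho.
- by move=> n [x|] /=.
- exact: k0.
move=> tau [st ktau tau_le tauP].
have mtau := measurable_stopping_time st.
have tau0 : forall w, 0 <= tau w by case: st.
have mS : measurable_fun setT (sample X tau : Omega -> cE) by exact: measurable_sample.
have mf : measurable_fun setT (fun w => tail_potential M g 0 (sample X tau w)).
  by apply: measurableT_comp mS => //; exact: measurable_tail_potential.
pose S := [set w | c%:E <= tail_potential M g 0 (sample X tau w)].
have pot_ge0 y : 0 <= tail_potential M g 0 y.
  by apply: integral_ge0 => w _; exact: integral_ge0.
have mS' : measurable S.
  rewrite -[X in measurable X]setTI.
  exact: emeasurable_fun_c_infty.
(* Markov's inequality at level c for the potential sampled at [tau]. *)
have cPS : c%:E * P z S <= tail_potential M g k z.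
  apply: le_trans (tail_potential_sample_le hausdorffE borelE g0 mg z gN k0 st ktau).
  have := le_integral_abse (P z) measurableT mf c0.
  rewrite setTI (_ : [set w | _] = S).
    by move/le_trans; apply; rewrite le_eqVlt; apply/orP; left; apply/eqP; apply: eq_integral => w _; rewrite gee0_abs.
  by apply/seteqP; split=> w; rewrite /S /= gee0_abs.
have neg : (P z).-negligible (\bigcup_n [set w | tau w < +oo /\ rh n (sample X tau w) != 0%R]).
  exact: negligible_bigcup.
have [N [mN N0 DN]] := neg.
apply: le_trans cPS; rewrite EFinM lee_pmul2l//; apply: (le_trans b_rho).
rewrite nuE; apply: (@le_trans _ _ (P z (S `|` N))).
  apply: le_measure; rewrite ?inE//.
  - apply: measurableI => //; rewrite -[X in measurable X]setTI; apply: (mY measurableT).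
    by apply: bigcapT_measurable => n; exact: measurable_zero_set.
  - exact: measurableU.
  (* Here [r w] is a visit to the closed set after time k, so [tau w <= r w] is finite; off the null
     set [N], the position at [tau] is in the closed set, hence in [B], where the potential is at
     least c. *)
  move=> w [/= zw Dw]; have [Nw|NN] := pselect (N w); first by right.
  left; have [_ kr Xr] := YP w Dw.
  have tau_r : tau w <= (r w)%:E.
    by apply: tau_le => // n; rewrite Xr /=; exact: zw.
  have tau_oo : tau w < +oo by rewrite (le_lt_trans tau_r)// ltry.
  have rh0 n : rh n (sample X tau w) = 0%R.
    apply/eqP/negPn/negP => rhn; apply: NN; apply: DN.
    by exists n.
  rewrite /S /=; case: (sample X tau w) rh0 => [x rh0|/(_ 0%N)/eqP].
    by apply: Bc; apply: rhoB => n _; exact: rh0.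
  by rewrite /rh oner_eq0.
by rewrite measureU0.
Qed.

End hitting_bound.

(** * Limits of tail potentials *)

Section tail_limits.
Context (R : realType) (E : ptopologicalType) (d : measure_display)
  (Omega : measurableType d) (M : right_process R E Omega).
Hypothesis borelE : borel_generated_by_continuous R E.
Local Notation cE := (borel (cemetery E)).
Local Notation leb := (@lebesgue_measure R).
Variable g : cE -> \bar R.
Hypothesis g0 : forall y, 0 <= g y.
Hypothesis mg : measurable_fun setT g.
Local Notation tail := (tail_potential M g).
Local Notation density z := (fun s => mean_occ M g 0 (s, z)).

Lemma tail_potential_ge0 a z : 0 <= tail a z.
Proof. by apply: integral_ge0 => w _; exact: integral_ge0. Qed.

Let density_ge0 z s : 0 <= density z s. Proof. exact: mean_occ_ge0. Qed.

Let measurable_density z : measurable_fun setT (density z).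
Proof.
have mz : measurable_fun setT (fun s : R => (s, z)) by exact: measurable_fun_pair.
exact: measurableT_comp (measurable_mean_occ M borelE g0 mg 0) mz.
Qed.

Lemma tail_potential_density a z : (0 <= a)%R ->
  tail a z = \int[leb]_(s in `[a, +oo[) density z s.
Proof.
move=> a0; rewrite (tail_potentialE M borelE g0 mg z a0).
apply: eq_integral => s; rewrite inE/= in_itv/= andbT => le_as.
have s0 := le_trans a0 le_as; rewrite /mean_occ /occ /= s0.
by apply: eq_integral => w _; rewrite max_l.
Qed.

Lemma tail_potential_nonincreasing a b z : (0 <= a)%R -> (a <= b)%R ->
  tail b z <= tail a z.
Proof.
move=> a0 ab; rewrite !tail_potential_density// ?(le_trans a0)//.
apply: ge0_subset_integral => //; first exact: measurable_funTS (measurable_density z).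
by move=> s /=; rewrite !in_itv/= !andbT; exact: le_trans.
Qed.

Lemma tail_potential_truncation z :
  \int[leb]_(s in `[0%R, n%:R[) density z s @[n --> \oo] --> tail 0 z.
Proof.
pose I n : set R := `[0%R, n%:R[%classic.
have mI n : measurable (I n) by exact: measurable_itv.
have IU : \bigcup_n I n = `[0%R, +oo[%classic.
  apply/seteqP; split=> s; first by move=> [n _]; rewrite /I /= !in_itv/= andbT => /andP[].
  rewrite /= in_itv/= andbT => s0; exists (Num.truncn s).+1 => //=.
  by rewrite /I /= in_itv/= s0 truncnS_gt.
rewrite tail_potential_density// -IU.
apply: ge0_nondecreasing_set_cvg_integral => //.
- move=> m n mn; apply/subsetPset => s; rewrite /I /= !in_itv/= => /andP[s0 sm].
  by rewrite s0 (lt_le_trans sm)// ler_nat.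
- by move=> n; exact: measurable_funTS (measurable_density z).
Qed.

Lemma tail_potential_cvg0 z : tail 0 z < +oo -> tail n%:R z @[n --> \oo] --> 0.
Proof.
move=> tail_fin.
pose I n : set R := `[0%R, n%:R[%classic.
have mI n : measurable (I n) by exact: measurable_itv.
have cvgI : \int[leb]_(s in I n) density z s @[n --> \oo] --> tail 0 z.
  exact: tail_potential_truncation.
have splitE n : tail 0 z = \int[leb]_(s in I n) density z s + tail n%:R z.
  rewrite !tail_potential_density//.
  have -> : `[0%R, +oo[%classic = I n `|` `[n%:R, +oo[%classic.
    by apply: itv_bndbnd_setU; rewrite bnd_simp.
  rewrite ge0_integral_setU//; [exact: mI|exact: measurable_funTS (measurable_density z)|].
  apply/disj_setPS => s [] /=; rewrite /I /= !in_itv/= andbT => /andP[_ sn] ns.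
  by move: sn; rewrite ltNge ns.
have fin0 : tail 0 z \is a fin_num by rewrite ge0_fin_numE// tail_potential_ge0.
have -> : (fun n => tail n%:R z) = (fun n => tail 0 z - \int[leb]_(s in I n) density z s).
  apply/funext => n; rewrite {1}(splitE n) addeC addeK//.
  rewrite ge0_fin_numE; last exact: integral_ge0.
  by apply: le_lt_trans tail_fin; rewrite (splitE n) leeDl// tail_potential_ge0.
rewrite -[X in _ --> X](subee fin0); apply: cvgeB => //; [exact: fin_num_adde_defr|exact: cvg_cst].
Qed.

(** The convergence of p_t u to u in the definition of excessivity, once p_t u is identified with
    the tail at t. It holds also where the potential is infinite, by monotone convergence. *)
Lemma tail_potential_at_right z : tail t z @[t --> 0%R^'+] --> tail 0 z.
Proof.
have -> : tail 0 z = ereal_sup ((tail ^~ z) @` [set` Interval (BRight 0%R) +oo%O]).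
  apply/eqP; rewrite eq_le; apply/andP; split; last first.
    apply: ge_ereal_sup => _ [t + <-]; rewrite /= in_itv/= andbT => t0.
    by apply: tail_potential_nonincreasing => //; exact: ltW.
  pose I n : set R := `[(n.+1%:R^-1)%R, +oo[%classic.
  have mI n : measurable (I n) by exact: measurable_itv.
  have IU : \bigcup_n I n = `]0%R, +oo[%classic.
    apply/seteqP; split=> s.
      by move=> [n _]; rewrite /I /= !in_itv/= !andbT; apply: lt_le_trans; rewrite invr_gt0.
    rewrite /= in_itv/= andbT => s0; exists (Num.truncn s^-1) => //=.
    by rewrite /I /= in_itv/= andbT ltW// invf_plt ?posrE// truncnS_gt.
  have cvgI : \int[leb]_(s in I n) density z s @[n --> \oo] --> tail 0 z.
    rewrite tail_potential_density// -integral_itv_obnd_cbnd; last exact: measurable_funTS (measurable_density z).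
    rewrite -IU; apply: ge0_nondecreasing_set_cvg_integral => //.
    - move=> m n mn; apply/subsetPset => s; rewrite /I /= !in_itv/= !andbT.
      by apply: le_trans; rewrite lef_pV2 ?posrE// ler_nat.
      - by move=> n; exact: measurable_funTS (measurable_density z).
  rewrite -(cvg_lim _ cvgI)//; apply: lime_le; first by apply/cvg_ex; eexists; exact: cvgI.
  apply: nearW => n; apply: ereal_sup_ubound; exists n.+1%:R^-1%R.
    by rewrite /= in_itv/= andbT invr_gt0.
  by rewrite tail_potential_density.
apply: nonincreasing_at_right_cvge => //.
move=> s t; rewrite !in_itv/= !andbT => s0 t0 st.
by apply: tail_potential_nonincreasing => //; exact: ltW.
Qed.

End tail_limits.

(** * Exhaustion of a transient process *)

Section transient_exhaustion.
Context (R : realType) (E : ptopologicalType) (d : measure_display)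
  (Omega : measurableType d) (M : right_process R E Omega).
Hypothesis hausdorffE : hausdorff_space E.
Hypothesis borelE : borel_generated_by_continuous R E.
Local Notation X := (rp_X M).
Local Notation P := (rp_P M).
Local Notation cE := (borel (cemetery E)).
Local Notation leb := (@lebesgue_measure R).

Lemma ae_initial (z : cE) : {ae P z, forall w, X 0%R w = z}.
Proof.
have m0 : measurable [set w | X 0%R w = z].
  rewrite -[X in measurable X]setTI.
  by apply: (@measurable_X _ _ _ _ M 0%R (lexx _) measurableT [set z]); exact: measurable_cemetery_point.
exists (~` [set w | X 0%R w = z]); split => //; first exact: measurableC.
by rewrite probability_setC// rp_normal subee.
Qed.

(** A path starting at the cemetery has lifetime 0 and stays there; thus [tail 0] is the extension
    by zero of its restriction to E. *)
Lemma tail_potential_None (g : cE -> \bar R) : (forall y, 0 <= g y) ->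
  measurable_fun setT g -> g None = 0 -> tail_potential M g 0 None = 0.
Proof.
move=> g0 mg gN; rewrite /tail_potential -[RHS](integral0 (P None) setT).
apply: ae_eq_integral => //; first exact: measurable_integral_occ.
apply: filterS (ae_initial None) => w X0 _ /=.
apply: integral0_eq => s; rewrite /= in_itv/= andbT => s0.
have /(rp_lifetime M w (lexx _)) zeta0 := X0.
suff -> : X s w = None by [].
apply/(rp_lifetime M w s0); apply: (le_trans zeta0).
by rewrite lee_fin.
Qed.

Lemma finely_open_subbase (A : set E) : fine_subbase M A -> finely_open M A.
Proof.
move=> sA; rewrite /finely_open; exists [set A].
  move=> _ ->; exists (finmap.fset1 A).
    by move=> B; rewrite finmap.in_fset1 => /eqP ->; rewrite inE.
  apply/seteqP; split=> x /=.
    by move=> /(_ A); apply; rewrite /= finmap.in_fset1.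
  by move=> Ax B /=; rewrite finmap.in_fset1 => /eqP ->.
by apply/seteqP; split=> x; [move=> [_ ->]|exists A].
Qed.

Section positive_potential.
Variable g : cE -> \bar R.
Hypothesis g0 : forall y, 0 <= g y.
Hypothesis mg : measurable_fun setT g.
Hypothesis gN : g None = 0.
Hypothesis g_gt0 : forall x, 0 < g (Some x).
Local Notation tail := (tail_potential M g).
Let u (x : E) : \bar R := tail 0 (Some x).

Lemma measurable_potential : measurable_fun setT (u : borel E -> \bar R).
Proof.
exact: measurableT_comp (measurable_tail_potential M borelE g0 mg (lexx _)) (@measurable_Some E).
Qed.

Lemma semigroup_potential t x : (0 <= t)%R -> semigroup M t u x = tail t (Some x).
Proof.
move=> t0; have tailE : ext0 u = tail 0.
  by apply/funext => -[y|] //=; rewrite tail_potential_None.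
have [_ eqt] := @tail_potential_strong_markov _ _ _ _ M hausdorffE borelE g g0 mg
  (Some x) _ gN (stopping_time_cst M t0).
rewrite /semigroup tailE; exact: eqt.
Qed.

Lemma potential_excessive : alpha_excessive M 0 u.
Proof.
split=> [x||s t x s0 st|x].
- exact: tail_potential_ge0.
- move=> B mB nu; exists (u @^-1` B), (u @^-1` B); split=> //.
  + by rewrite -[X in measurable X]setTI; exact: measurable_potential.
  + by rewrite -[X in measurable X]setTI; exact: measurable_potential.
  + by rewrite setDv measure0.
- have t0 := lt_le_trans s0 st.
  rewrite !mul0r !oppr0 expR0 !mul1e (semigroup_potential _ (ltW s0)).
  rewrite (semigroup_potential _ (ltW t0)).
  exact: (tail_potential_nonincreasing M borelE g0 mg _ (ltW s0) st).
- have eq_tail : \forall t \near 0%R^'+, tail t (Some x) =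
      (expR (- (0 * t)))%:E * semigroup M t u x.
    near=> t; have t0 : (0 <= t)%R by apply: ltW; near: t; exact: nbhs_right_gt.
    by rewrite mul0r oppr0 expR0 mul1e (semigroup_potential _ t0).
  have := @tail_potential_at_right _ _ _ _ M borelE g g0 mg (Some x).
  by apply: cvg_trans; exact: near_eq_cvg.
Unshelve. all: by end_near. Qed.

(** If [u x] were 0, some path from x would have zero occupation integral. But E is open in the
    extension, so that path stays in E on an interval after 0, where [g] is positive. *)
Lemma potential_gt0 x : 0 < u x.
Proof.
rewrite lt_neqAle tail_potential_ge0// andbT; apply/negP => /eqP u0.
have [N [mN N0 NJ]] : ae_eq (P (Some x)) setT
    (fun w => \int[leb]_(s in `[0%R, +oo[) g (X s w)) (cst 0).
  apply/ae_eq_integral_abs => //; first exact: measurable_integral_occ.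
  rewrite -[RHS]/(0%E) u0; apply: eq_integral => w _.
  by rewrite gee0_abs// integral_ge0.
have [N' [mN' N'0 NX]] := ae_initial (Some x).
have [w Nw] : exists w, ~ (N `|` N') w.
  apply: contrapT => /forallNP NN.
  have : P (Some x) (N `|` N') = 1.
    rewrite -(probability_setT (P (Some x))); congr (P _ _).
    by apply/seteqP; split=> // w _; apply: contrapT; exact: NN.
  by rewrite measureU0// N0 => /eqP; rewrite eq_sym onee_eq0.
have X0 : X 0%R w = Some x by apply: contrapT => h; apply: Nw; right; exact: NX.
have J0 : \int[leb]_(s in `[0%R, +oo[) g (X s w) = 0.
  apply: contrapT => h; apply: Nw; left; apply: NJ => /(_ Logic.I); exact: h.
have oE : open (@Some E @` setT : set (cemetery E)).
  rewrite cemetery_openE (_ : _ @^-1` _ = setT); first exact: openT.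
  by apply/seteqP; split=> // y _; exists y.
have [|e e0 eP] := @open_right _ _ _ _ M (@Some E @` setT : set (cemetery E)) w 0%R oE (lexx _).
  by rewrite X0; exists x.
rewrite integral_occ// in J0.
have mw : measurable_fun setT (fun s : R => (s, w)) by exact: measurable_fun_pair.
have mo := measurableT_comp (measurable_occ M borelE mg 0) mw.
have : ae_eq leb setT (fun s => occ M g 0 (s, w)) (cst 0).
  apply/ae_eq_integral_abs => //; rewrite -[RHS]J0; apply: eq_integral => s _.
  by rewrite gee0_abs// occ_ge0.
move=> [N1 [mN1 N10 NN1]].
have : leb `]0%R, e[%classic <= leb N1.
  apply: le_measure; rewrite ?inE//.
  move=> s /=; rewrite in_itv/= => /andP[s0 se].
  have := NN1 s; apply => /(_ Logic.I).
  rewrite /occ /= ltW//= max_l ?ltW//.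
  have [|y _ <-] := eP s s0; first by rewrite add0r.
  by move=> gy0; move: (g_gt0 y); rewrite gy0 ltxx.
by rewrite N10 lebesgue_measure_itv/= lte_fin e0 oppr0 adde0 lee_fin leNgt e0.
Qed.

(** If infinite last exit had outer probability above e, [hitting_bound] would keep every tail of
    the potential above c e / 2, whereas the tails of a finite potential tend to 0. *)
Lemma last_exit_potential (c : R) x : (0 < c)%R -> u x < +oo ->
  {ae P (Some x), forall w, last_exit M [set y | c%:E < u y] w < +oo}.
Proof.
move=> c0 ux; set B := [set y | _].
have mB : measurable (B : set (borel E)).
  rewrite -[X in measurable X]setTI.
  by apply: emeasurable_fun_o_infty => //; exact: measurable_potential.
apply: negligible_outer => e e0 bigL.
have hit (k : nat) : (c * (e / 2))%:E <= tail k%:R (Some x).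
  (* Halving e provides the strict loss that [hitting_bound] requires. *)
  have e2 : (e / 2 < e)%R by rewrite ltr_pdivrMr// ltr_pMr// ltr1n.
  apply: (hitting_bound hausdorffE borelE g0 mg gN mB c0 (ler0n _ k) _ _ e2).
    by move=> y; exact: ltW.
  apply: outer_gtS bigL => w /= /negP; rewrite -leNgt leye_eq => /eqP Loo.
  have : k%:R%:E < last_exit M B w by rewrite Loo ltry.
  move=> /ereal_sup_gt[_ [t tP <-]]; rewrite lte_fin => kt.
  case: tP => [t0|[t0 Bt]]; last by exists t => //; exact: ltW.
  by move: kt; rewrite t0 ltNge ler0n.
have := tail_potential_cvg0 borelE g0 mg ux.
move=> /cvg_lim => lim0.
have : (c * (e / 2))%:E <= 0.
  rewrite -[leRHS]lim0//; apply: lime_ge; last exact: nearW.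
  by apply/cvg_ex; exists 0; exact: tail_potential_cvg0.
by rewrite lee_fin leNgt mulr_gt0// divr_gt0.
Qed.

End positive_potential.
End transient_exhaustion.

(** * Positive modification of the witness and the exhausting sets *)

Section transient_only_if.
Context (R : realType) (E : ptopologicalType) (d : measure_display)
  (Omega : measurableType d) (M : right_process R E Omega).
Hypothesis hausdorffE : hausdorff_space E.
Hypothesis borelE : borel_generated_by_continuous R E.
Variable mu : {sigma_finite_measure set (borel E) -> \bar R}.
Hypothesis excessive_mu : excessive_measure M mu.
Local Notation X := (rp_X M).
Local Notation P := (rp_P M).
Local Notation cE := (borel (cemetery E)).
Local Notation leb := (@lebesgue_measure R).

Lemma measurable_path (f : cE -> \bar R) w : measurable_fun setT f ->
  measurable_fun (`[0%R, +oo[%classic : set R) (fun s => f (X s w)).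
Proof.
move=> mf; apply: (eq_measurable_fun (fun s : R => f (X (Num.max s 0%R) w))).
  by move=> s; rewrite inE/= in_itv/= andbT => s0; rewrite max_l.
have mw : measurable_fun setT (fun s : R => (s, w)) by exact: measurable_fun_pair.
apply: measurable_funTS; apply: (measurableT_comp mf).
exact: measurableT_comp (joint_measurable_X M borelE) mw.
Qed.

(** Excessivity bounds the mu-integral of p_s 1_Z by mu(Z) = 0 for each s > 0; integrating over s,
    the potential of [Z] has zero mu-integral. *)
Lemma potential_null_set (Z : set (borel E)) : measurable Z -> mu Z = 0 ->
  {ae mu, forall x, tail_potential M (ext0 (EFin \o \1_Z)) 0 (Some x) = 0}.
Proof.
move=> mZ muZ; pose g : cE -> \bar R := ext0 (EFin \o \1_Z).
have g0 y : 0 <= g y by case: y => [x|] //=; rewrite lee_fin.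
have mg : measurable_fun setT g.
  by apply: measurable_ext0; apply/measurable_EFinP; exact: measurable_indic.
pose f (p : R * borel E) : \bar R := mean_occ M g 0 (p.1, Some p.2).
have f0 p : 0 <= f p by exact: mean_occ_ge0.
have mf : measurable_fun setT f.
  have mp : measurable_fun setT (fun p : R * borel E => (p.1, Some p.2 : cE)).
    apply: measurable_fun_pair; first exact: measurable_fst.
    exact: measurableT_comp (@measurable_Some E) measurable_snd.
  exact: measurableT_comp (measurable_mean_occ M borelE g0 mg 0) mp.
have mq : measurable_fun setT (fun x : borel E => tail_potential M g 0 (Some x)).
  exact: measurableT_comp (measurable_tail_potential M borelE g0 mg (lexx _)) (@measurable_Some E).
suff : \int[mu]_x tail_potential M g 0 (Some x) = 0.
  move=> q0; have : ae_eq mu setT (fun x => tail_potential M g 0 (Some x)) (cst 0).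
    apply/ae_eq_integral_abs => //; rewrite -[RHS]q0; apply: eq_integral => x _.
    by rewrite gee0_abs// tail_potential_ge0.
  by apply: filterS => x; exact.
transitivity (\int[mu]_x \int[leb]_s f (s, x)).
  by apply: eq_integral => x _; rewrite (tail_mean_occ M borelE g0 mg).
rewrite -(fubini_tonelli (m1 := leb) (m2 := mu) f mf f0).
have mF := measurable_fun_fubini_tonelli_F (m2 := mu) f mf f0.
rewrite -[RHS](integral0 leb setT); apply: ae_eq_integral => //.
(* Excessivity of mu is stated for s > 0 only, so time 0 is the exceptional point; negative times
   contribute 0 by definition of [occ]. *)
exists [set 0%R]; split; [exact: measurable_set1|exact: lebesgue_measure_set1|].
move=> s /= /not_implyP[_ fs]; apply: contrapT => /eqP s0; apply: fs.
have [s_gt0|s_le0] := ltP 0%R s; last first.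
  apply: integral0_eq => x _; rewrite /f /mean_occ /occ /= leNgt lt_neqAle s0 s_le0 /=.
  exact: integral0.
apply/eqP; rewrite eq_le; apply/andP; split; last exact: integral_ge0.
rewrite -muZ; apply: le_trans (excessive_mu mZ s_gt0).
rewrite le_eqVlt; apply/orP; left; apply/eqP; apply: eq_integral => x _.
rewrite /f /mean_occ /occ /= ltW//=; apply: eq_integral => w _.
by rewrite max_l// ltW.
Qed.

(** A zero potential of the set where [g] and [k] differ means that almost every path from x spends
    zero Lebesgue time in it. *)
Lemma potential_modification (g k : borel E -> \bar R) (x : E) :
  measurable_fun setT g -> measurable_fun setT k -> (forall y, 0 <= k y) ->
  measurable [set y | g y != k y] ->
  tail_potential M (ext0 (EFin \o \1_[set y | g y != k y])) 0 (Some x) = 0 ->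
  tail_potential M (ext0 g) 0 (Some x) = tail_potential M (ext0 k) 0 (Some x).
Proof.
move=> mg mk k0; set Z := [set y | _] => mZ q0.
pose iZ : cE -> \bar R := ext0 (EFin \o \1_Z).
have iZ0 y : 0 <= iZ y by case: y => [v|] //=; rewrite lee_fin.
have miZ : measurable_fun setT iZ.
  by apply: measurable_ext0; apply/measurable_EFinP; exact: measurable_indic.
have mint (h : cE -> \bar R) : measurable_fun setT h -> (forall y, 0 <= h y) ->
    measurable_fun setT (fun w => \int[leb]_(s in `[0%R, +oo[) h (X s w)).
  by move=> mh h0; exact: measurable_integral_occ.
have mek := measurable_ext0 mk; have meg := measurable_ext0 mg.
apply: ae_eq_integral => //.
(* [g] may be negative on the exceptional set, hence the split into positive and negative parts to
   get measurability. *)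
- rewrite (_ : (fun w => _) = (fun w =>
      \int[leb]_(s in `[0%R, +oo[) ((ext0 g)^\+ (X s w)) -
      \int[leb]_(s in `[0%R, +oo[) ((ext0 g)^\- (X s w)))).
    by apply: emeasurable_funB; apply: mint => //; [exact: measurable_funepos|exact: measurable_funeneg].
  apply/funext => w; rewrite integralE; congr (_ - _); apply: eq_integral => s _.
    by rewrite !funeposE.
  by rewrite !funenegE.
- by apply: mint => //; case=> [y|] /=.
have : ae_eq (P (Some x)) setT
    (fun w => \int[leb]_(s in `[0%R, +oo[) iZ (X s w)) (cst 0).
  apply/ae_eq_integral_abs => //; first exact: mint.
  rewrite -[RHS]q0; apply: eq_integral => w _.
  by rewrite gee0_abs// integral_ge0.
apply: filterS => w /(_ Logic.I) /= IZ0 _.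
apply: ae_eq_integral => //; [exact: measurable_path|exact: measurable_path|].
have : ae_eq leb (`[0%R, +oo[%classic : set R) (fun s => iZ (X s w)) (cst 0).
  apply/ae_eq_integral_abs => //; first exact: measurable_path.
  by rewrite -[RHS]IZ0; apply: eq_integral => s _; rewrite gee0_abs.
apply: filterS => s h s0; have {h} := h s0.
case: (X s w) => //= y; rewrite indicE; case: (boolP (y \in Z)) => [_ [] /eqP|].
  by rewrite oner_eq0.
by rewrite notin_setE /Z /= => /negP; rewrite negbK => /eqP.
Qed.

Lemma transient_exhaustion : transient M mu ->
  exists B : nat -> set E,
    [/\ forall n, measurable (B n : set (borel E)),
        forall n, finely_open M (B n),
        forall n, B n `<=` B n.+1,
        mu.-negligible (~` (\bigcup_n B n) : set (borel E))
      & forall n, {ae mu, forall x,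
          {ae P (Some x), forall w, last_exit M (B n) w < +oo}}].
Proof.
move=> [g [gint gpos gfin]].
have mg : measurable_fun setT g by exact/measurable_EFinP/measurable_int/gint.
(* Positivity everywhere, not just almost everywhere, makes the potential positive everywhere; any
   positive default would do. *)
pose k (x : borel E) : \bar R := if (0 < g x)%R then (g x)%:E else 1.
have mk : measurable_fun setT k.
  apply: measurable_fun_ifT => //; last exact/measurable_EFinP.
  exact: measurable_fun_ltr.
have k_gt0 x : 0 < k x by rewrite /k; case: ifP => //; rewrite lte_fin.
pose gk : cE -> \bar R := ext0 k.
have gk0 y : 0 <= gk y by case: y => [x|] //=; exact: ltW.
have mgk : measurable_fun setT gk by exact: measurable_ext0.
pose u (x : E) := tail_potential M gk 0 (Some x).
have mu_ : measurable_fun setT (u : borel E -> \bar R) by exact: measurable_potential.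
have ufin : {ae mu, forall x, u x < +oo}.
  pose Z : set (borel E) := [set y | (g y)%:E != k y].
  have mZ : measurable Z.
    have mg' : measurable_fun setT (fun y => (g y)%:E) by exact/measurable_EFinP.
    rewrite -[X in measurable X]setTI.
    exact: measurable_neqe.
  have muZ : mu Z = 0.
    apply/negligibleP => //; apply: negligibleS gpos => y /= + gy.
    by rewrite /Z /= /k gy eqxx.
  apply: (@filterS2 _ _ (ae_filter_ringOfSetsType mu) _ _ _ _ gfin
    (potential_null_set mZ muZ)) => x gx qx; rewrite /u -(@potential_modification (EFin \o g) k)//.
  + exact/measurable_EFinP.
  + by move=> y; exact: ltW.
have u_gt0 x : 0 < u x by exact: potential_gt0.
exists (fun n => [set x | n.+1%:R^-1%:E < u x]); split.
- move=> n; rewrite -[X in measurable X]setTI.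
  exact: emeasurable_fun_o_infty.
- move=> n; apply: finely_open_subbase; exists 0%R, u; split => //.
    exact: potential_excessive.
  exists [set y | n.+1%:R^-1%:E < y] => //; exact: open_ereal_gt_ereal.
- move=> n x /=; apply: le_lt_trans; rewrite lee_fin lef_pV2 ?posrE//.
  by rewrite ler_nat.
(* The sets cover E entirely, points of infinite potential included: those are already in the set of
   index 0. *)
- rewrite (_ : ~` _ = set0); first exact: negligible_set0.
  apply/seteqP; split=> // x; apply => /=; have := u_gt0 x.
  case ux : (u x) => [r| |]// r0; last by exists 0%N => //=; rewrite ux ltry.
  rewrite lte_fin in r0; exists (Num.truncn r^-1) => //=.
  by rewrite ux lte_fin invf_plt ?posrE// truncnS_gt.
- move=> n; apply: (@filterS _ _ (ae_filter_ringOfSetsType mu) _ _ _ ufin) => x ux.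
  by apply: (last_exit_potential hausdorffE borelE gk0 mgk).
Qed.

End transient_only_if.

(** * Hitting probabilities of the discrete skeleton *)

Section discrete_hitting.
Context (R : realType) (E : ptopologicalType) (d : measure_display)
  (Omega : measurableType d) (M : right_process R E Omega).
Hypothesis hausdorffE : hausdorff_space E.
Hypothesis borelE : borel_generated_by_continuous R E.
Local Notation X := (rp_X M).
Local Notation P := (rp_P M).
Local Notation F := (rp_filtration M).
Local Notation cE := (borel (cemetery E)).
Local Notation leb := (@lebesgue_measure R).

Definition transition (t : R) (f : cE -> \bar R) (z : cE) : \bar R :=
  \int[P z]_w f (X t w).

Lemma transition_ge0 t f z : (forall y, 0 <= f y) -> 0 <= transition t f z.
Proof. by move=> f0; exact: integral_ge0. Qed.

Lemma measurable_fX t (f : cE -> \bar R) : (0 <= t)%R -> measurable_fun setT f ->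
  measurable_fun setT (fun w => f (X t w)).
Proof. by move=> t0 mf; exact: measurableT_comp mf (@measurable_X _ _ _ _ M t t0). Qed.

Lemma measurable_transition t f : (0 <= t)%R -> (forall y, 0 <= f y) ->
  measurable_fun setT f -> measurable_fun setT (transition t f).
Proof.
move=> t0 f0 mf.
have h := @measurable_expectation _ _ _ _ M (fun p => f (X t p.2)) (fun p => f0 _).
have mh : measurable_fun setT (fun p : R * path_space M => f (X t p.2)).
  have mX : measurable_fun setT (fun p : R * path_space M => X t p.2 : cE).
    have ms : measurable_fun setT (snd : R * path_space M -> path_space M).
      exact: measurable_snd.
    have := measurableT_comp (@measurable_X_path _ _ _ _ M t t0) ms; exact.
  exact: measurableT_comp mf mX.
have mz : measurable_fun setT (fun z : cE => (0%R : R, z)) by exact: measurable_fun_pair.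
exact: measurableT_comp (h mh) mz.
Qed.

Lemma transition_le t f f' z : (0 <= t)%R -> (forall y, 0 <= f y) ->
  measurable_fun setT f -> measurable_fun setT f' -> (forall y, f y <= f' y) ->
  transition t f z <= transition t f' z.
Proof.
by move=> t0 f0 mf mf' ff'; apply: ge0_le_integral => //; exact: measurable_fX.
Qed.

Lemma markov_property s t f z (L : set Omega) : (0 <= s)%R -> (0 <= t)%R ->
  (forall y, 0 <= f y) -> measurable_fun setT f -> F s L ->
  \int[P z]_(w in L) transition t f (X s w) = \int[P z]_(w in L) f (X (s + t)%R w).
Proof.
move=> s0 t0 f0 mf FL.
apply: (strong_markov hausdorffE borelE z (stopping_time_cst M s0) t0 _ mf f0).
split.
  by have [_ + _ _] := rp_filtrationP M; apply; first exact: s0.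
move=> r r0; have [sr|rs] := leP s r.
  rewrite [X in F r X](_ : _ = L); first exact: filtrationS FL.
  by apply/seteqP; split=> w /=; [case|move=> Lw; split=> //; rewrite lee_fin].
rewrite [X in F r X](_ : _ = set0); first by apply/filtrationE.
by apply/seteqP; split=> w //= [_]; rewrite lee_fin leNgt rs.
Qed.

Lemma transitionD s t f z : (0 <= s)%R -> (0 <= t)%R ->
  (forall y, 0 <= f y) -> measurable_fun setT f ->
  transition s (transition t f) z = transition (s + t) f z.
Proof.
move=> s0 t0 f0 mf; apply: markov_property => //.
apply/filtrationE => //; exact: measurableT.
Qed.

Variable B : set (borel E).
Hypothesis mB : measurable B.
Let SB : set cE := @Some E @` B.
Let mSB : measurable SB. Proof. exact: measurable_image_Some. Qed.

(* hit n y is the probability that the skeleton X_0, X_1, ..., X_n started at y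
   meets B. *)
Fixpoint hit (n : nat) (y : cE) : \bar R :=
  if y \in SB then 1 else if n is m.+1 then transition 1 (hit m) y else 0.

Lemma hit_ge0 n y : 0 <= hit n y.
Proof.
elim: n y => [|n IH] y /=; case: ifP => // _.
exact: transition_ge0.
Qed.

Let measurable_inSB : measurable_fun setT (fun y : cE => y \in SB).
Proof.
apply: (measurable_fun_bool true); rewrite setTI.
rewrite [X in measurable X](_ : _ = SB)//.
by apply/seteqP; split=> y /=; [move/set_mem|move/mem_set].
Qed.

Lemma measurable_hit n : measurable_fun setT (hit n).
Proof.
elim: n => [|n IH] /=; apply: measurable_fun_ifT => //.
by apply: measurable_transition => //; exact: hit_ge0.
Qed.

Lemma hit_le1 n y : hit n y <= 1.
Proof.
elim: n y => [|n IH] y /=; case: ifP => // _.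
rewrite -(probability_setT (P y)) -[leRHS]mul1e -integral_cst//.
apply: ge0_le_integral => //; first by move=> w _; exact: hit_ge0.
by apply: measurable_fX => //; exact: measurable_hit.
Qed.

Lemma hit_nd n m y : (n <= m)%N -> hit n y <= hit m y.
Proof.
elim: n m y => [|n IH] [|m] y //=; case: ifP => // _ nm.
  by apply: transition_ge0; exact: hit_ge0.
apply: transition_le => //; [exact: hit_ge0|exact: measurable_hit|exact: measurable_hit|].
by move=> y'; exact: IH.
Qed.

(** Induction on n, splitting [L] by whether X_k is in [B]; on the other part the Markov property
    moves the problem to step k+1. The event [L] is kept general so that the induction can carry
    this restriction. *)
Lemma integral_hit_le n (k : nat) z (L : set Omega) : F k%:R L ->
  \int[P z]_(w in L) hit n (X k%:R w) <=
  P z (L `&` \bigcup_(j in [set j | (k <= j)%N]) X j%:R @^-1` SB).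
Proof.
have mL k' L' : F k'%:R L' -> measurable L'.
  by have [_ + _ _] := rp_filtrationP M; apply.
have mT k' L' : measurable L' ->
    measurable (L' `&` \bigcup_(j in [set j | (k' <= j)%N]) X j%:R @^-1` SB).
  move=> mL'; apply: measurableI => //; apply: bigcup_measurable => j _.
  by rewrite -[X in measurable X]setTI; exact: measurable_X.
elim: n k L => [|n IH] k L FL; have mLk := mL _ _ FL.
  rewrite [leLHS](_ : _ = \int[P z]_(w in L) (\1_(X k%:R @^-1` SB) w)%:E).
    rewrite integral_indic//; last first.
      by rewrite -[X in measurable X]setTI; exact: measurable_X.
    apply: le_measure; rewrite ?inE.
    - apply: measurableI => //.
      by rewrite -[X in measurable X]setTI; exact: measurable_X.
    - exact: mT.
    - by move=> w [XB Lw]; split=> //; exists k => /=.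
  apply: eq_integral => w _; rewrite /= indicE.
  by rewrite (_ : (w \in _) = (X k%:R w \in SB))//; case: ifP.
set A := X k%:R @^-1` SB.
have mA : measurable A by rewrite /A -[X in measurable X]setTI; exact: measurable_X.
have FA : F k%:R A by exact: rp_adapted.
have FLA : F k%:R (L `\` A).
  apply/filtrationE => //; apply: measurableD; exact/filtrationE.
have k1 : (k.+1%:R = k%:R + 1 :> R)%R by rewrite -natr1.
have mhX : measurable_fun setT (fun w => hit n.+1 (X k%:R w)).
  by apply: measurable_fX => //; exact: measurable_hit.
rewrite -[in leLHS](setUIDK L A) ge0_integral_setU//; last 5 first.
- exact: measurableI.
- exact: measurableD.
- exact: measurable_funTS.
- by move=> w _; exact: hit_ge0.
- by apply/disj_setPS => w [[_ Aw] [_ nAw]].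
rewrite [X in _ <= P z X](_ : _ = (L `&` A) `|` ((L `\` A) `&`
    \bigcup_(j in [set j | (k.+1 <= j)%N]) X j%:R @^-1` SB)).
  rewrite measureU//; last 3 first.
  - exact: measurableI.
  - by apply: mT; exact: measurableD.
  - by apply/seteqP; split=> w // [[_ Aw] [[_ nAw] _]].
  apply: leeD.
    rewrite (eq_integral (cst 1)) ?integral_cst ?mul1e//; first exact: measurableI.
    by move=> w /set_mem[_ Aw]; rewrite /hit mem_set.
  rewrite (eq_integral (fun w => transition 1 (hit n) (X k%:R w))); last first.
    by move=> w /set_mem[_ nAw] /=; rewrite memNset.
  rewrite markov_property//; [|exact: hit_ge0|exact: measurable_hit].
  rewrite -k1; apply: IH; apply: filtrationS FLA => //.
  by rewrite ler_nat.
apply/seteqP; split=> w.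
  move=> [Lw [j /= kj Xj]]; have [Aw|nAw] := pselect (A w); first by left.
  right; split=> //; exists j => //=.
  by rewrite ltn_neqAle kj andbT; apply/eqP => kE; apply: nAw; rewrite /A kE.
move=> [[Lw Aw]|[[Lw _] [j /= kj Xj]]].
  by split=> //; exists k => /=.
by split=> //; exists j => //=; exact: ltnW.
Qed.

Definition ever (y : cE) : \bar R := limn (hit ^~ y).

Lemma hit_cvg y : hit ^~ y @ \oo --> ever y.
Proof. by apply: ereal_nondecreasing_is_cvgn => n m; exact: hit_nd. Qed.

Lemma measurable_ever : measurable_fun setT ever.
Proof.
apply: (emeasurable_fun_cvg hit); first exact: measurable_hit.
by move=> y _; exact: hit_cvg.
Qed.

Lemma hit_le_ever n y : hit n y <= ever y.
Proof.
apply: lime_ge; first by apply/cvg_ex; eexists; exact: hit_cvg.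
by exists n => // m /=; exact: hit_nd.
Qed.

Lemma ever_ge0 y : 0 <= ever y.
Proof. exact: le_trans (hit_ge0 0 y) (hit_le_ever 0 y). Qed.

Lemma ever_le1 y : ever y <= 1.
Proof.
apply: lime_le; first by apply/cvg_ex; eexists; exact: hit_cvg.
by apply: nearW => n; exact: hit_le1.
Qed.

Lemma transition_le1 t f z : (0 <= t)%R -> (forall y, 0 <= f y) ->
  measurable_fun setT f -> (forall y, f y <= 1) -> transition t f z <= 1.
Proof.
move=> t0 f0 mf f1; rewrite -(probability_setT (P z)) -[leRHS]mul1e -integral_cst//.
by apply: ge0_le_integral => //; exact: measurable_fX.
Qed.

Lemma transition_ever_cvg z t : (0 <= t)%R ->
  transition t (hit n) z @[n --> \oo] --> transition t ever z.
Proof.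
move=> t0; apply: cvg_monotone_convergence => //.
- by move=> n; apply: measurable_fX => //; exact: measurable_hit.
- by move=> n w _; exact: hit_ge0.
- by move=> w _ n m; exact: hit_nd.
Qed.

(** One step suffices: p_1 applied to [hit n] equals [hit n.+1] off [B], and is at most 1, its
    value, on [B]. *)
Lemma transition_ever_le k z : transition k.+1%:R ever z <= ever z.
Proof.
have step y : transition 1 ever y <= ever y.
  rewrite -(cvg_lim _ (@transition_ever_cvg y _ ler01))//.
  apply: lime_le; first by apply/cvg_ex; eexists; exact: transition_ever_cvg.
  apply: nearW => n; apply: le_trans (hit_le_ever n.+1 y) => /=.
  case: ifP => // _; apply: transition_le1 => //; first exact: hit_ge0.
    exact: measurable_hit.
  exact: hit_le1.
elim: k z => [|k IH] z; first exact: step.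
have Eever0 := ever_ge0; have mever := measurable_ever.
rewrite -natr1 addrC -transitionD//; apply: le_trans (step z).
apply: transition_le => //; last exact: measurable_transition.
by move=> y; exact: transition_ge0.
Qed.

Lemma transition_ever_late k z : transition k%:R ever z <=
  P z (\bigcup_(j in [set j | (k <= j)%N]) X j%:R @^-1` SB).
Proof.
rewrite -(cvg_lim _ (@transition_ever_cvg z _ (ler0n _ k)))//.
apply: lime_le; first by apply/cvg_ex; eexists; exact: transition_ever_cvg.
apply: nearW => n.
rewrite -[X in P z X]setTI; apply: integral_hit_le.
by apply/filtrationE => //; exact: measurableT.
Qed.

(** The probability that the skeleton meets [B] but no longer does so from step k+1 on. The shift in
    k leaves out the zero difference at time 0. *)
Definition escape (k : nat) (y : cE) : \bar R :=
  ever y - transition k.+1%:R ever y.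

Let measurable_P k : measurable_fun setT (transition k.+1%:R ever).
Proof. by apply: measurable_transition => //; [exact: ever_ge0|exact: measurable_ever]. Qed.

Let P_ge0 k y : 0 <= transition k.+1%:R ever y.
Proof. by apply: transition_ge0; exact: ever_ge0. Qed.

Let P_fin k y : transition k.+1%:R ever y \is a fin_num.
Proof.
rewrite ge0_fin_numE//; apply: le_lt_trans (transition_ever_le k y) _.
by apply: le_lt_trans (ever_le1 y) _; rewrite ltry.
Qed.

Lemma escape_ge0 k y : 0 <= escape k y.
Proof. rewrite /escape sube_ge0; last by rewrite P_fin. exact: transition_ever_le. Qed.

Lemma escape_le1 k y : escape k y <= 1.
Proof. by rewrite /escape leeBlDr// (le_trans (ever_le1 y))// leeDl. Qed.

Lemma measurable_escape k : measurable_fun setT (escape k).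
Proof. by apply: emeasurable_funB => //; exact: measurable_ever. Qed.

(* Telescoping: the potential of H - p_(k+1) H is the integral of p_s H over
   [0, k+1), where H = ever, up to truncation since p_s H need not be
   integrable. *)
Lemma escape_potential_le k z : tail_potential M (escape k) 0 z <= k.+1%:R%:E.
Proof.
pose phi s := mean_occ M ever 0 (s, z).
pose psi s := mean_occ M (escape k) 0 (s, z).
have mz : measurable_fun setT (fun s : R => (s, z)) by exact: measurable_fun_pair.
have mphi : measurable_fun setT phi.
  exact: measurableT_comp (measurable_mean_occ M borelE ever_ge0 measurable_ever 0) mz.
have mpsi : measurable_fun setT psi.
  exact: measurableT_comp (measurable_mean_occ M borelE (escape_ge0 k) (measurable_escape k) 0) mz.
have phi0 s : 0 <= phi s by apply: mean_occ_ge0; exact: ever_ge0.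
have psi0 s : 0 <= psi s by apply: mean_occ_ge0; exact: escape_ge0.
have phiE s : (0 <= s)%R -> phi s = transition s ever z.
  by move=> s0; rewrite /phi /mean_occ /occ /= s0 max_l.
have psiE s : (0 <= s)%R -> psi s = transition s (escape k) z.
  by move=> s0; rewrite /psi /mean_occ /occ /= s0 max_l.
(* [phi] and [psi] are p_s H and p_s(H - p_(k+1) H); this is the semigroup property. *)
have split s : (0 <= s)%R -> phi s = psi s + phi (k.+1%:R + s)%R.
  move=> s0; rewrite !phiE// ?addr_ge0// psiE// [(k.+1%:R + s)%R]addrC -transitionD//; last 2 first.
  - exact: ever_ge0.
  - exact: measurable_ever.
  rewrite /transition -ge0_integralD//.
  - apply: eq_integral => w _; rewrite /escape subeK//; exact: P_fin.
  - by move=> w _; exact: escape_ge0.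
  - by apply: measurable_fX => //; exact: measurable_escape.
  - by move=> w _; exact: P_ge0.
  - exact: (measurable_fX s0 (@measurable_P k)).
have phi1 s : phi s <= 1.
  have [s0|s0] := leP 0%R s.
    rewrite phiE//; apply: transition_le1 => //;
      [exact: ever_ge0|exact: measurable_ever|exact: ever_le1].
  by rewrite /phi /mean_occ /occ /= (leNgt 0%R s) s0 integral0.
have phi_itv (a b : R) : (a <= b)%R ->
    \int[leb]_(s in `[a, b[) phi s <= (b - a)%:E.
  move=> ab; apply: (@le_trans _ _ (\int[leb]_(s in `[a, b[) cst 1 s)).
    by apply: ge0_le_integral => //; exact: measurable_funTS.
  rewrite integral_cst// mul1e /= lebesgue_measure_itv/= lte_fin -EFinB.
  by case: ifP => // _; rewrite lee_fin subr_ge0.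
(* The integral of [phi] over [0, n) is that of [psi] plus [J], and at most that of [phi] over [0,
   k+1) plus [J]. As [phi] is at most 1, [J] is finite and cancels, leaving k+1. *)
have trunc (n : nat) : \int[leb]_(s in `[0%R, n%:R[) psi s <= k.+1%:R%:E.
  pose J := \int[leb]_(s in `[k.+1%:R, (k.+1%:R + n%:R)%R[) phi s.
  have kn : (k.+1%:R <= k.+1%:R + n%:R :> R)%R by rewrite lerDl.
  have Jfin : J \is a fin_num.
    rewrite ge0_fin_numE; last by apply: integral_ge0.
    by apply: le_lt_trans (phi_itv _ _ kn) _; rewrite ltry.
  rewrite -(leeD2rE _ _ Jfin).
  have <- : \int[leb]_(s in `[0%R, n%:R[) phi s =
      \int[leb]_(s in `[0%R, n%:R[) psi s + J.
    have -> : J = \int[leb]_(s in `[0%R, n%:R[) phi (k.+1%:R + s)%R.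
      rewrite /J -(@integral_shift _ k.+1%:R)//; last exact: measurable_funTS.
      congr integral; apply/seteqP; split=> s /=; rewrite !in_itv/= lerDl ltrD2l//.
    rewrite -ge0_integralD//.
    - by apply: eq_integral => s /set_mem /=; rewrite in_itv/= => /andP[s0 _]; exact: split.
    - exact: measurable_funTS.
    - apply: measurable_funTS; apply: measurableT_comp mphi _.
      exact: measurable_funD.
  apply: (@le_trans _ _ (\int[leb]_(s in `[0%R, (k.+1%:R + n%:R)%R[) phi s)).
    apply: ge0_subset_integral => //; first exact: measurable_funTS.
    by move=> s /=; rewrite !in_itv/= => /andP[-> sn]; rewrite (lt_le_trans sn)// lerDr.
  have -> : `[0%R, (k.+1%:R + n%:R)%R[%classic =
      `[0%R, k.+1%:R[%classic `|` `[k.+1%:R, (k.+1%:R + n%:R)%R[%classic :> set R.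
    by apply: itv_bndbnd_setU; rewrite bnd_simp.
  rewrite ge0_integral_setU//; last 2 first.
  - exact: measurable_funTS.
  - apply/disj_setPS => s [] /=; rewrite !in_itv/= => /andP[_ sk] /andP[ks _].
    by move: sk; rewrite ltNge ks.
  by apply: leeD => //; rewrite -[X in _ <= X%:E]subr0 phi_itv.
rewrite -(cvg_lim _ (@tail_potential_truncation _ _ _ _ M borelE _ (escape_ge0 k) (measurable_escape k) z))//.
apply: lime_le; last by apply: nearW.
by apply/cvg_ex; eexists; exact: (@tail_potential_truncation _ _ _ _ M borelE _ (escape_ge0 k) (measurable_escape k) z).
Qed.

(** At x in [B] one has H(x) = 1. If every [escape k] vanished there, the skeleton would visit [B]
    after each step with probability one, hence infinitely often, forcing an infinite last exit
    time. *)
Lemma escape_gt0 x : B x ->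
  {ae P (Some x), forall w, last_exit M B w < +oo} ->
  exists k, 0 < escape k (Some x).
Proof.
move=> Bx lastB.
have ever1 : ever (Some x) = 1.
  apply/eqP; rewrite eq_le ever_le1 /= (le_trans _ (hit_le_ever 0 _))//=.
  by rewrite mem_set//; exists x.
pose T k := \bigcup_(j in [set j | (k <= j)%N]) X j%:R @^-1` SB.
have mT k : measurable (T k).
  apply: bigcup_measurable => j _.
  by rewrite -[X in measurable X]setTI; exact: measurable_X.
have T0 : P (Some x) (\bigcap_k T k) = 0.
  have [N [mN N0 NT]] := lastB.
  apply: subset_measure0 N0 => //; first exact: bigcap_measurable.
  move=> w Tw; apply: NT => /=.
  have jL j : X j%:R w \in SB -> j%:R%:E <= last_exit M B w.
    by move=> /set_mem Xj; apply: ereal_sup_ubound; exists j%:R => //; right.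
  case: (last_exit M B w) jL => [r|_|] jL //.
    have [j /= rj Xj] := Tw (Num.truncn r).+1 Logic.I.
    have := jL _ (mem_set Xj); rewrite lee_fin leNgt => /negP jr _; apply: jr.
    by apply: lt_le_trans (truncnS_gt r) _; rewrite ler_nat.
  by have [j _ /mem_set/jL] := Tw 0%N Logic.I; rewrite leeNy_eq.
apply: contrapT => /forallNP noesc.
have cvgT : P (Some x) \o T @ \oo --> 0.
  rewrite -T0; apply: nonincreasing_cvg_mu => //.
  - by apply: le_lt_trans (probability_le1 _ _) _; rewrite ?ltry.
  - exact: bigcap_measurable.
  - move=> m n mn; apply/subsetPset => w [j /= nj Xj].
    by exists j => //=; exact: leq_trans nj.
have : 1 <= limn (P (Some x) \o T).
  apply: lime_ge; first by apply/cvg_ex; exists 0.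
  (* Only indices k >= 1 are compared with [escape], whose times start at 1. *)
  exists 1%N => // -[//|k] _ /=.
  have := noesc k; rewrite lt_neqAle escape_ge0 andbT => /negP/negbNE/eqP esc0.
  apply: le_trans (transition_ever_late k.+1 (Some x)).
  by rewrite -sube_le0 -ever1 -/(escape k (Some x)) -esc0.
by rewrite (cvg_lim _ cvgT)// leNgt lte01.
Qed.

End discrete_hitting.

(** * Mixing countably many potentials into a transience witness *)

Section mixing.
Context (R : realType) (E : ptopologicalType) (d : measure_display)
  (Omega : measurableType d) (M : right_process R E Omega).
Hypothesis hausdorffE : hausdorff_space E.
Hypothesis borelE : borel_generated_by_continuous R E.
Local Notation X := (rp_X M).
Local Notation P := (rp_P M).
Local Notation cE := (borel (cemetery E)).
Local Notation leb := (@lebesgue_measure R).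

Let integralE (g : cE -> \bar R) (g0 : forall y, 0 <= g y) :
  (forall w, \int[leb]_(s in `[0%R, +oo[) g (X s w) = \int[leb]_s occ M g 0 (s, w)).
Proof. by move=> w; rewrite integral_occ. Qed.

Let measurable_occ_section (g : cE -> \bar R) w : measurable_fun setT g ->
  measurable_fun setT (fun s : R => occ M g 0 (s, w)).
Proof.
move=> mg; have mw : measurable_fun setT (fun s : R => (s, w)) by exact: measurable_fun_pair.
exact: measurableT_comp (measurable_occ M borelE mg 0) mw.
Qed.

Lemma tail_potential_le (g g' : cE -> \bar R) z : (forall y, 0 <= g y) ->
  measurable_fun setT g -> measurable_fun setT g' -> (forall y, g y <= g' y) ->
  tail_potential M g 0 z <= tail_potential M g' 0 z.
Proof.
move=> g0 mg mg' gg'; have g'0 y : 0 <= g' y by exact: le_trans (gg' y).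
apply: ge0_le_integral => //.
- by move=> w _; exact: integral_ge0.
- exact: measurable_integral_occ.
- exact: measurable_integral_occ.
move=> w _; rewrite !integralE//; apply: ge0_le_integral => //.
- by move=> s _; exact: occ_ge0.
- exact: measurable_occ_section.
- exact: measurable_occ_section.
- by move=> s _; rewrite /occ; case: ifP.
Qed.

Lemma tail_potentialZl (c : R) (g : cE -> \bar R) z : (0 <= c)%R ->
  (forall y, 0 <= g y) -> measurable_fun setT g ->
  tail_potential M (fun y => c%:E * g y) 0 z = c%:E * tail_potential M g 0 z.
Proof.
move=> c0 g0 mg; rewrite /tail_potential -ge0_integralZl//; last 2 first.
- exact: measurable_integral_occ.
- by move=> w _; exact: integral_ge0.
apply: eq_integral => w _; rewrite integralE// (integralE (g := fun y => c%:E * g y)); last first.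
  by move=> y; exact: mule_ge0.
rewrite -ge0_integralZl//; last 2 first.
- exact: measurable_occ_section.
- by move=> s _; exact: occ_ge0.
by apply: eq_integral => s _; rewrite /occ; case: ifP => // _; rewrite mule0.
Qed.

Lemma tail_potential_nneseries (g : nat -> cE -> \bar R) z :
  (forall i y, 0 <= g i y) -> (forall i, measurable_fun setT (g i)) ->
  tail_potential M (fun y => \sum_(i <oo) g i y) 0 z =
  \sum_(i <oo) tail_potential M (g i) 0 z.
Proof.
move=> g0 mg; rewrite /tail_potential -integral_nneseries//; last 2 first.
- by move=> i; exact: measurable_integral_occ.
- by move=> i w _; exact: integral_ge0.
apply: eq_integral => w _.
transitivity (\int[leb]_s occ M (fun y => \sum_(i <oo) g i y) 0 (s, w)).
  by apply: (integralE (g := fun y => \sum_(i <oo) g i y)) => y; exact: nneseries_ge0.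
under eq_eseriesr do rewrite integralE//.
rewrite -integral_nneseries//; last 2 first.
- by move=> i; exact: measurable_occ_section.
- by move=> i s _; exact: occ_ge0.
apply: eq_integral => s _; rewrite /occ; case: ifP => // _.
by rewrite eseries0.
Qed.

Let summable_half (a : nat -> \bar R) : (forall i, 0 <= a i) ->
  (forall i, a i <= (1 / (2 ^ i.+1)%:R)%:E) -> \sum_(i <oo) a i <= 1.
Proof.
move=> a0 ah; apply: le_trans (epsilon_trick0 xpredT ler01).
exact: lee_nneseries.
Qed.

Lemma transient_mixture (mu : {measure set (borel E) -> \bar R})
    (g : nat -> borel E -> \bar R) (c : nat -> R) :
  (forall i, measurable_fun setT (g i)) -> (forall i x, 0 <= g i x <= 1) ->
  (forall i, 0 <= c i)%R -> (forall i, \int[mu]_x g i x <= (c i)%:E) ->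
  (forall i x, tail_potential M (ext0 (g i)) 0 (Some x) <= (c i)%:E) ->
  {ae mu, forall x, exists i, 0 < g i x} -> transient M mu.
Proof.
move=> mg g01 c0 gc Uc gpos.
have g0 i x : 0 <= g i x by have /andP[] := g01 i x.
(* The factor 1 + c i dominates at once the sup norm, the mu-integral and the potential of [g i], so
   the same geometric series bounds all three by 1. *)
pose a i := (1 / (2 ^ i.+1)%:R / (1 + c i))%R.
have c1 i : (0 < 1 + c i)%R by rewrite ltr_pwDl.
have a_gt0 i : (0 < a i)%R by rewrite !divr_gt0// ltr0n expn_gt0.
have a0 i := ltW (a_gt0 i).
have a_le i (x : \bar R) : x <= (1 + c i)%:E ->
    (a i)%:E * x <= (1 / (2 ^ i.+1)%:R)%:E.
  move=> xc; apply: (@le_trans _ _ ((a i)%:E * (1 + c i)%:E)).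
    by apply: lee_wpmul2l => //; rewrite lee_fin.
  by rewrite -EFinM /a divfK// gt_eqF.
have leD1 i : (c i <= 1 + c i)%R by rewrite lerDr.
pose S x := \sum_(i <oo) (a i)%:E * g i x.
have ag0 i x : 0 <= (a i)%:E * g i x by rewrite mule_ge0// lee_fin.
have S0 x : 0 <= S x by exact: nneseries_ge0.
have mag i : measurable_fun setT (fun x => (a i)%:E * g i x) by exact: measurable_funeM.
have mS : measurable_fun setT S.
  by apply: ge0_emeasurable_sum => // i x _ _.
have S1 x : S x <= 1.
  apply: summable_half => // i; apply: a_le; have /andP[_ g1] := g01 i x.
  by apply: le_trans g1 _; rewrite lee_fin lerDl.
have Sfin x : S x \is a fin_num.
  by rewrite ge0_fin_numE//; apply: le_lt_trans (S1 x) _; rewrite ltry.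
have SE : EFin \o (fine \o S) = S by apply/funext => x /=; rewrite fineK.
exists (fine \o S); rewrite SE; split.
- apply/integrableP; split=> //.
  under eq_integral do rewrite gee0_abs//.
  rewrite integral_nneseries//; apply: (@le_lt_trans _ _ 1); last by rewrite ltry.
  apply: summable_half => i; first exact: integral_ge0.
  rewrite ge0_integralZl//; last by rewrite lee_fin.
  by apply: a_le; apply: le_trans (gc i) _; rewrite lee_fin.
- apply: filterS gpos => x [i gi]; 
  have ai0 : 0 < (a i)%:E * g i x by rewrite mule_gt0// lte_fin.
  rewrite fine_gt0//; apply/andP; split; last by rewrite -ge0_fin_numE.
  apply: lt_le_trans ai0 _; apply: le_trans (nneseries_lim_ge i.+1 _) => //.
  by rewrite big_nat_recr//= leeDr// sume_ge0.
- apply: aeW => x.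
  rewrite -[X in X < _]/(tail_potential M (ext0 S) 0 (Some x)).
  rewrite (_ : ext0 S = fun y => \sum_(i <oo) (a i)%:E * ext0 (g i) y); last first.
    by apply/funext => -[y//|] /=; rewrite eseries0// => i; rewrite mule0.
  have eg0 i y : 0 <= ext0 (g i) y by case: y => [y|] /=.
  have meg i : measurable_fun setT (ext0 (g i) : cE -> \bar R) by exact: measurable_ext0.
  rewrite tail_potential_nneseries; last 2 first.
  - by move=> i y; rewrite mule_ge0// lee_fin.
  - by move=> i; exact: measurable_funeM.
  apply: (@le_lt_trans _ _ 1); last by rewrite ltry.
  apply: summable_half => i; rewrite tail_potentialZl//.
    by rewrite mule_ge0 ?lee_fin// tail_potential_ge0.
  by apply: a_le; apply: le_trans (Uc i x) _; rewrite lee_fin.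
Qed.

(* Cutting the escape functions down to sets of finite mu-measure makes them
   integrable without affecting the bound on their potentials. *)
Lemma exhaustion_transient (mu : {sigma_finite_measure set (borel E) -> \bar R})
    (B : nat -> set (borel E)) :
  (forall n, measurable (B n)) -> mu.-negligible (~` \bigcup_n B n) ->
  (forall n, {ae mu, forall x,
     {ae P (Some x), forall w, last_exit M (B n) w < +oo}}) ->
  transient M mu.
Proof.
move=> mB covB lastB.
have [F FT mF] := sigma_finiteT mu.
pose g0 (p : nat * (nat * nat)) (x : borel E) : \bar R :=
  escape M (B p.1) p.2.1 (Some x) * (\1_(F p.2.2) x)%:E.
pose c0 (p : nat * (nat * nat)) : R := (p.2.1.+1%:R + fine (mu (F p.2.2)))%R.
pose g i x := if unpickle i is Some p then g0 p x else 0.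
pose c i := if unpickle i is Some p then c0 p else 0%R.
have esc0 n k y : 0 <= escape M (B n) k y by exact: escape_ge0.
have esc1 n k y : escape M (B n) k y <= 1 by exact: escape_le1.
have mesc n k : measurable_fun setT (escape M (B n) k) by exact: measurable_escape.
have mescS n k : measurable_fun setT (fun x : borel E => escape M (B n) k (Some x)).
  exact: measurableT_comp (mesc n k) (@measurable_Some E).
have mind m : measurable_fun setT (fun x : borel E => (\1_(F m) x)%:E : \bar R).
  by apply/measurable_EFinP; apply: measurable_indic; exact: (mF m).1.
have mu_fin m : mu (F m) = (fine (mu (F m)))%:E.
  by rewrite fineK// ge0_fin_numE//; exact: (mF m).2.
have mg0 p : measurable_fun setT (g0 p) by exact: emeasurable_funM.
have g0_ge0 p x : 0 <= g0 p x by rewrite mule_ge0// lee_fin.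
have g0_le_ind p x : g0 p x <= (\1_(F p.2.2) x)%:E.
  by rewrite -[leRHS]mul1e lee_wpmul2r// lee_fin.
have g0_le_esc p x : g0 p x <= escape M (B p.1) p.2.1 (Some x).
  by rewrite -[leRHS]mule1 lee_wpmul2l// lee_fin indicE; case: (_ \in _).
apply: (@transient_mixture mu g c).
- by move=> i; rewrite /g; case: unpickle.
- move=> i x; rewrite /g; case: unpickle => [p|]; last by rewrite lexx lee01.
  by rewrite g0_ge0 (le_trans (g0_le_esc p x)).
- move=> i; rewrite /c; case: unpickle => // p.
  by rewrite addr_ge0// fine_ge0.
- move=> i; rewrite /g /c; case: unpickle => [p|]; last by rewrite integral0.
  apply: (@le_trans _ _ (mu (F p.2.2))); last first.
    by rewrite [leLHS]mu_fin lee_fin lerDr.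
  rewrite -[X in mu X]setIT -integral_indic//; last exact: (mF _).1.
  by apply: ge0_le_integral.
- move=> i x; rewrite /g /c; case: unpickle => [p|]; last first.
    rewrite /tail_potential integral0_eq// => w _.
    by rewrite integral0_eq// => s _; case: (X s w).
  apply: (@le_trans _ _ (tail_potential M (escape M (B p.1) p.2.1) 0 (Some x))).
    apply: tail_potential_le => //.
    - by case=> [y|] /=.
    - exact: measurable_ext0.
    - by case=> [y|] /=.
  apply: le_trans (escape_potential_le M hausdorffE borelE (mB _) _ _) _.
  by rewrite lee_fin lerDl fine_ge0.
- have covB' : {ae mu, forall x, (\bigcup_n B n) x} by [].
  have lastB' := ae_foralln lastB.
  apply: (@filterS2 _ _ (ae_filter_ringOfSetsType mu) _ _ _ _ covB' lastB').
  move=> x [n _ Bx] lastx.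
  have [k esck] := escape_gt0 hausdorffE borelE (mB n) Bx (lastx n).
  have [m _ Fx] : (\bigcup_m F m) x by rewrite -FT.
  exists (pickle (n, (k, m))); rewrite /g pickleK /g0/= indicE mem_set//.
  by rewrite mule1.
Qed.

End mixing.

Theorem proposition10 (R : realType) (E : ptopologicalType)
    (hausdorffE : hausdorff_space E)
    (borelE : borel_generated_by_continuous R E)
    (mu : {sigma_finite_measure set (borel E) -> \bar R})
    (d : measure_display) (Omega : measurableType d)
    (M : right_process R E Omega)
    (excessive_mu : excessive_measure M mu)
    (excessive_nearly_borel :
       forall u : E -> \bar R, excessive M u -> nearly_borel M u) :
  transient M mu <->
  exists B : nat -> set E,
    [/\ forall n, measurable (B n : set (borel E)),
        forall n, finely_open M (B n),
        forall n, B n `<=` B n.+1,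
        mu.-negligible (~` (\bigcup_n B n) : set (borel E))
      & forall n, {ae mu, forall x,
          {ae rp_P M (Some x), forall w, last_exit M (B n) w < +oo}}].
Proof.
split; first exact: transient_exhaustion.
by move=> [B [mB _ _ covB lastB]]; exact: exhaustion_transient covB lastB.
Qed.
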